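(* Let $(E,C)$ be a separated graph and let $K$ be a commutative unital ring with involution. Then the natural homomorphism $\iota\colon\mathcal{LI}(E,C)\to\mathcal L_K^{\mathrm{ab}}(E,C)$ is injective. Hence the multiplicative semigroup of $\mathcal L_K^{\mathrm{ab}}(E,C)$ generated by $E^0\cup E^1\cup(E^1)^*$ is naturally isomorphic to the Leavitt inverse semigroup $\mathcal{LI}(E,C)$.
   Context: A directed graph $E=(E^0,E^1,s,r)$ has arbitrary sets of vertices and edges and source/range maps $s,r$. A separated graph $(E,C)$ is a directed graph with $C=\bigsqcup_{v\in E^0}C_v$, where $C_v$ is a partition of $s^{-1}(v)$ into pairwise disjoint nonempty subsets ($C_v=\emptyset$ if $s^{-1}(v)=\emptyset$). For $e\in E^1$ let $e^{-1}$ be a formal inverse with $s(e^{-1})=r(e)$, $r(e^{-1})=s(e)$; $E^{-1}=\{e^{-1}:e\in E^1\}$, $\hat E^1=E^1\cup E^{-1}$. $\mathcal{LI}(E,C)$ (the Leavitt inverse semigroup) is the universal inverse semigroup (with zero) generated by $E^0\cup E^1\cup E^{-1}$ subject to: (1) $vw=\delta_{v,w}v$ for $v,w\in E^0$; (2) $s(x)x=x$ and (3) $xr(x)=x$ for $x\in\hat E^1$; (4) $e^{-1}f=\delta_{e,f}r(e)$ for $e,f\in X$, $X\in C$; (5) $ee^{-1}=s(e)$ for all $e\in E^1$ with $\{e\}\in C$. The Leavitt path algebra $\mathcal L_K(E,C)$ is the universal $*$-algebra over $K$ generated by self-adjoint elements $v\in E^0$ and elements $e\in E^1$ subject to: $vw=\delta_{v,w}v$;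 $s(e)e=e=er(e)$; $e^*s(e)=e^*=r(e)e^*$; $e^*f=\delta_{e,f}r(e)$ for $e,f\in X$, $X\in C$; and $\sum_{e\in X}ee^*=v$ for every finite $X\in C_v$, $v\in E^0$. The tame Leavitt path algebra $\mathcal L_K^{\mathrm{ab}}(E,C)$ is its quotient by the two-sided ideal generated by all commutators $[xx^*,yy^*]$, with $x,y$ in the multiplicative $*$-subsemigroup generated by $E^0\cup E^1$. The natural homomorphism $\iota$ is the multiplicative map with $\iota(v)=v$, $\iota(e)=e$, $\iota(e^{-1})=e^*$ and $\iota(0)=0$.
   Formalization: The ring K is taken nonzero (for K = 0 the algebra collapses and injectivity fails as soon as there is a vertex), and the multiplicative semigroup generated by the vertices, edges and their adjoints is understood to include 0. *)

(* Defs.v *)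
From HB Require Import structures.
From mathcomp Require Import all_boot all_order all_algebra sesquilinear.
From mathcomp Require Import finmap all_classical.

Set Implicit Arguments.
Unset Strict Implicit.
Unset Printing Implicit Defensive.

Import GRing.Theory.

Local Open Scope classical_set_scope.
Local Open Scope quotient_scope.
Local Open Scope ring_scope.

Reserved Notation "x ** y" (at level 40, left associativity).
Notation "x ** y" := (monoid.mul x y) : ring_scope.

(* The product of a (non-unital) semigroup is written [**], since [*] is the   *)
(* product of a unital ring in [ring_scope].                                  *)

HB.mixin Record Semigroup_isInvSemigroup0 S of Semigroup S := {
  szero : S;
  pinv : S -> S;
  mul0s : forall x : S, szero ** x = szero;
  muls0 : forall x : S, x ** szero = szero;
  mulsVs : forall x : S, x ** pinv x ** x = x;
  mulVsV : forall x : S, pinv x ** x ** pinv x = pinv x;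
  pinv_uniq : forall x y : S, x ** y ** x = x -> y ** x ** y = y -> y = pinv x
}.

#[short(type="invSemigroup0Type")]
HB.structure Definition InvSemigroup0 :=
  {S of Semigroup_isInvSemigroup0 S & Semigroup S}.

(* Inverse semigroups as a variety: the same axioms define [iscong] below. *)
HB.factory Record Semigroup_isInvSemigroup0Eq S of Semigroup S := {
  szero : S;
  pinv : S -> S;
  mul0s : forall x : S, szero ** x = szero;
  muls0 : forall x : S, x ** szero = szero;
  pinvK : involutive pinv;
  pinvM : forall x y : S, pinv (x ** y) = pinv y ** pinv x;
  mulsVs : forall x : S, x ** pinv x ** x = x;
  mulsVC : forall x y : S,
    x ** pinv x ** (y ** pinv y) = y ** pinv y ** (x ** pinv x)
}.

HB.builders Context S of Semigroup_isInvSemigroup0Eq S.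

Let mulVsV (x : S) : pinv x ** x ** pinv x = pinv x.
Proof. by rewrite -{2}[x]pinvK mulsVs. Qed.

Let idemE (e : S) : e ** e = e -> e = e ** pinv e.
Proof.
move=> ee; have eVV : pinv e ** pinv e = pinv e by rewrite -pinvM ee.
have eV : pinv e = e.
  have -> : pinv e = pinv e ** e ** (e ** pinv e).
    by rewrite mulgA -[_ ** e ** e]mulgA ee mulVsV.
  have:= mulsVC (pinv e) e; rewrite pinvK => ->.
  by rewrite mulgA -[e ** _ ** pinv e]mulgA eVV mulsVs.
by rewrite eV ee.
Qed.

Let idemC (e f : S) : e ** e = e -> f ** f = f -> e ** f = f ** e.
Proof. by move=> /idemE -> /idemE ->; rewrite mulsVC. Qed.

Let pinv_uniq (x y : S) : x ** y ** x = x -> y ** x ** y = y -> y = pinv x.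
Proof.
move=> xyx yxy.
have i1 : (x ** y) ** (x ** y) = x ** y by rewrite mulgA xyx.
have i2 : (x ** pinv x) ** (x ** pinv x) = x ** pinv x by rewrite mulgA mulsVs.
have j1 : (y ** x) ** (y ** x) = y ** x by rewrite mulgA yxy.
have j2 : (pinv x ** x) ** (pinv x ** x) = pinv x ** x by rewrite mulgA mulVsV.
have Ey : y = y ** (x ** pinv x).
  transitivity (y ** (x ** pinv x ** (x ** y))); last first.
    by rewrite (idemC i2 i1) mulgA [y ** (x ** y)]mulgA yxy.
  by rewrite [x ** pinv x ** (x ** y)]mulgA mulsVs mulgA yxy.
have Ez : pinv x = y ** x ** pinv x.
  transitivity (pinv x ** x ** (y ** x) ** pinv x); last first.
    by rewrite (idemC j2 j1) -mulgA mulVsV.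
  by rewrite -[pinv x ** x ** _]mulgA [x ** (y ** x)]mulgA xyx mulVsV.
by rewrite Ez -mulgA -Ey.
Qed.

HB.instance Definition _ := Semigroup_isInvSemigroup0.Build S
  mul0s muls0 mulsVs mulVsV pinv_uniq.

HB.end.

Section InvSemigroup0Theory.

Variable S : invSemigroup0Type.
Implicit Types x y e f : S.

Lemma pinv_mulsVs_pinv x : pinv (pinv x) = x.
Proof. by symmetry; apply: pinv_uniq; rewrite ?mulVsV ?mulsVs. Qed.

Lemma pinv_idem e : e ** e = e -> pinv e = e.
Proof. by move=> ee; symmetry; apply: pinv_uniq; rewrite !ee. Qed.

Lemma idem_mul e f : e ** e = e -> f ** f = f -> (e ** f) ** (e ** f) = e ** f.
Proof.
move=> ee ff; pose z := pinv (e ** f).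
have z1 : e ** f ** z ** (e ** f) = e ** f by apply: mulsVs.
have z2 : z ** (e ** f) ** z = z by apply: mulVsV.
have zE : f ** z ** e = z.
  apply: pinv_uniq.
    rewrite -[RHS]z1 -!mulgA [f ** (f ** _)]mulgA ff.
    by rewrite [e ** (e ** f)]mulgA ee.
  rewrite -[in RHS]z2 -!mulgA [e ** (e ** _)]mulgA ee.
  by rewrite [f ** (f ** _)]mulgA ff.
have zz : z ** z = z.
  rewrite -{1 2}zE -!mulgA [e ** (f ** _)]mulgA [z ** (_ ** _)]mulgA.
  by rewrite [z ** (e ** f) ** _]mulgA z2 mulgA.
have -> : e ** f = z by rewrite -[e ** f]pinv_mulsVs_pinv -/z pinv_idem.
exact: zz.
Qed.

Lemma idem_comm e f : e ** e = e -> f ** f = f -> e ** f = f ** e.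
Proof.
move=> ee ff; rewrite -[LHS]pinv_idem ?idem_mul//; symmetry.
have efef := idem_mul ee ff; have fefe := idem_mul ff ee.
apply: pinv_uniq.
  rewrite -[RHS]efef -!mulgA [f ** (f ** _)]mulgA ff.
  by rewrite [e ** (e ** _)]mulgA ee.
rewrite -[RHS]fefe -!mulgA [e ** (e ** _)]mulgA ee.
by rewrite [f ** (f ** _)]mulgA ff.
Qed.

Lemma pinv_range_idem x : (x ** pinv x) ** (x ** pinv x) = x ** pinv x.
Proof. by rewrite mulgA mulsVs. Qed.

Lemma pinv_source_idem x : (pinv x ** x) ** (pinv x ** x) = pinv x ** x.
Proof. by rewrite mulgA mulVsV. Qed.

Lemma pinv_mul x y : pinv (x ** y) = pinv y ** pinv x.
Proof.
have C := idem_comm (pinv_source_idem x) (pinv_range_idem y).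
symmetry; apply: pinv_uniq.
  rewrite -!mulgA [y ** (pinv y ** _)]mulgA [pinv x ** (x ** y)]mulgA.
  rewrite [y ** pinv y ** _]mulgA -C -!mulgA.
  by rewrite [y ** (pinv y ** y)]mulgA mulsVs 2!mulgA mulsVs.
rewrite -!mulgA [pinv x ** (x ** _)]mulgA [y ** (pinv y ** _)]mulgA.
rewrite [pinv x ** x ** _]mulgA C -!mulgA.
by rewrite [pinv x ** (x ** _)]mulgA mulVsV 2!mulgA mulVsV.
Qed.

End InvSemigroup0Theory.

Inductive isterm (X : Type) : Type :=
| ISgen of X
| ISzero
| ISmul of isterm X & isterm X
| ISinv of isterm X.
Arguments ISzero {X}.

Inductive iscong (X : Type) (R : isterm X -> isterm X -> Prop) :
  isterm X -> isterm X -> Prop :=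
| iscong_rel a b : R a b -> iscong R a b
| iscong_refl a : iscong R a a
| iscong_sym a b : iscong R a b -> iscong R b a
| iscong_trans a b c : iscong R a b -> iscong R b c -> iscong R a c
| iscong_mul a a' b b' :
    iscong R a a' -> iscong R b b' -> iscong R (ISmul a b) (ISmul a' b')
| iscong_inv a a' : iscong R a a' -> iscong R (ISinv a) (ISinv a')
| iscong_mulA a b c : iscong R (ISmul a (ISmul b c)) (ISmul (ISmul a b) c)
| iscong_mul0 a : iscong R (ISmul ISzero a) ISzero
| iscong_0mul a : iscong R (ISmul a ISzero) ISzero
| iscong_invK a : iscong R (ISinv (ISinv a)) a
| iscong_invM a b :
    iscong R (ISinv (ISmul a b)) (ISmul (ISinv b) (ISinv a))
| iscong_mulV a : iscong R (ISmul (ISmul a (ISinv a)) a) a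
| iscong_idemC a b :
    iscong R (ISmul (ISmul a (ISinv a)) (ISmul b (ISinv b)))
             (ISmul (ISmul b (ISinv b)) (ISmul a (ISinv a))).

HB.instance Definition _ (X : Type) := gen_eqMixin (isterm X).
HB.instance Definition _ (X : Type) := gen_choiceMixin (isterm X).

Section ISPresentation.

Variables (X : Type) (R : isterm X -> isterm X -> Prop).

Definition iscongb (a b : isterm X) : bool := `[< iscong R a b >].

Lemma iscongb_refl : reflexive iscongb.
Proof. by move=> a; apply/asboolP/iscong_refl. Qed.

Lemma iscongb_sym : symmetric iscongb.
Proof. by move=> a b; apply/asboolP/asboolP => /iscong_sym. Qed.

Lemma iscongb_trans : transitive iscongb.
Proof.
move=> b a c /asboolP ab /asboolP bc.
by apply/asboolP/(iscong_trans ab bc).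
Qed.

Canonical iscong_equiv :=
  EquivRel iscongb iscongb_refl iscongb_sym iscongb_trans.

Definition ispres : Type := {eq_quot iscong_equiv}.
HB.instance Definition _ := Choice.on ispres.
HB.instance Definition _ := EqQuotient.on ispres.

Definition is_pi (a : isterm X) : ispres := \pi_ispres a.

Lemma is_piP a b : is_pi a = is_pi b <-> iscong R a b.
Proof.
split=> [/eqmodP|ab]; first by move/asboolP.
by apply/eqmodP/asboolP.
Qed.

Lemma is_reprK (x : ispres) : is_pi (repr x) = x.
Proof. exact: reprK. Qed.

Lemma is_repr_pi a : iscong R (repr (is_pi a)) a.
Proof. by apply/is_piP; rewrite is_reprK. Qed.

Definition is_mul (x y : ispres) : ispres := is_pi (ISmul (repr x) (repr y)).
Definition is_inv (x : ispres) : ispres := is_pi (ISinv (repr x)).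

Lemma is_pi_mul a b : is_mul (is_pi a) (is_pi b) = is_pi (ISmul a b).
Proof. by apply/is_piP/iscong_mul; apply: is_repr_pi. Qed.

Lemma is_pi_inv a : is_inv (is_pi a) = is_pi (ISinv a).
Proof. by apply/is_piP/iscong_inv/is_repr_pi. Qed.

Lemma is_mulA : associative is_mul.
Proof.
move=> x y z; rewrite -[x]is_reprK -[y]is_reprK -[z]is_reprK !is_pi_mul.
exact/is_piP/iscong_mulA.
Qed.

HB.instance Definition _ := isSemigroup.Build ispres is_mulA.

Lemma is_mulE (x y : ispres) : x ** y = is_mul x y.
Proof. by []. Qed.

Lemma is_mul0s (x : ispres) : is_pi ISzero ** x = is_pi ISzero.
Proof. by rewrite is_mulE -[x]is_reprK is_pi_mul; apply/is_piP/iscong_mul0. Qed.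

Lemma is_muls0 (x : ispres) : x ** is_pi ISzero = is_pi ISzero.
Proof. by rewrite is_mulE -[x]is_reprK is_pi_mul; apply/is_piP/iscong_0mul. Qed.

Lemma is_invK : involutive is_inv.
Proof.
by move=> x; rewrite -[x]is_reprK !is_pi_inv; apply/is_piP/iscong_invK.
Qed.

Lemma is_invM (x y : ispres) : is_inv (x ** y) = is_inv y ** is_inv x.
Proof.
rewrite !is_mulE -[x]is_reprK -[y]is_reprK !(is_pi_mul, is_pi_inv).
exact/is_piP/iscong_invM.
Qed.

Lemma is_mulsVs (x : ispres) : x ** is_inv x ** x = x.
Proof.
rewrite !is_mulE -[x]is_reprK !(is_pi_mul, is_pi_inv).
exact/is_piP/iscong_mulV.
Qed.

Lemma is_mulsVC (x y : ispres) :
  x ** is_inv x ** (y ** is_inv y) = y ** is_inv y ** (x ** is_inv x).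
Proof.
rewrite !is_mulE -[x]is_reprK -[y]is_reprK !(is_pi_mul, is_pi_inv).
exact/is_piP/iscong_idemC.
Qed.

HB.instance Definition _ := Semigroup_isInvSemigroup0Eq.Build ispres
  is_mul0s is_muls0 is_invK is_invM is_mulsVs is_mulsVC.

End ISPresentation.

Section ISUniversal.

Variables (X : Type) (S : invSemigroup0Type) (f : X -> S).

Fixpoint is_eval (a : isterm X) : S :=
  match a with
  | ISgen x => f x
  | ISzero => szero
  | ISmul a b => is_eval a ** is_eval b
  | ISinv a => pinv (is_eval a)
  end.

Variable R : isterm X -> isterm X -> Prop.

Definition is_lift (x : ispres R) : S := is_eval (repr x).

Hypothesis fR : forall a b, R a b -> is_eval a = is_eval b.

Lemma is_eval_cong a b : iscong R a b -> is_eval a = is_eval b.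
Proof.
elim=> //=.
- by move=> {}a {}b c _ -> _ ->.
- by move=> {}a a' {}b b' _ -> _ ->.
- by move=> {}a a' _ ->.
- by move=> *; rewrite mulgA.
- by move=> *; rewrite mul0s.
- by move=> *; rewrite muls0.
- by move=> *; rewrite pinv_mulsVs_pinv.
- by move=> *; rewrite pinv_mul.
- by move=> *; rewrite mulsVs.
- by move=> *; rewrite (idem_comm (pinv_range_idem _) (pinv_range_idem _)).
Qed.

Lemma is_lift_pi a : is_lift (is_pi R a) = is_eval a.
Proof. exact/is_eval_cong/is_repr_pi. Qed.

Lemma is_lift_gen x : is_lift (is_pi R (ISgen x)) = f x.
Proof. exact: is_lift_pi. Qed.

Lemma is_lift0 : is_lift szero = szero.
Proof. exact: (is_lift_pi ISzero). Qed.

Lemma is_liftM : {morph is_lift : x y / x ** y}.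
Proof.
move=> x y; rewrite is_mulE -[x]is_reprK -[y]is_reprK is_pi_mul.
by rewrite !is_lift_pi.
Qed.

Lemma is_lift_uniq (g : ispres R -> S) :
  (forall x, g (is_pi R (ISgen x)) = f x) -> g szero = szero ->
  {morph g : x y / x ** y} -> g =1 is_lift.
Proof.
move=> gX g0 gM x; rewrite -[x]is_reprK is_lift_pi.
elim: (repr x) => [y|//|a IHa b IHb|a IHa] /=; first exact: gX.
- by rewrite -IHa -IHb -gM is_mulE is_pi_mul.
- have gV y : g (pinv y) = pinv (g y).
    by apply: pinv_uniq; rewrite -!gM ?mulsVs ?mulVsV.
  by rewrite -IHa -gV -(is_pi_inv R a).
Qed.

End ISUniversal.
Arguments is_lift {X S} f {R} x.

HB.mixin Record isStarAlgebra (K : comNzRingType) (conj : involutive_rmorphism K)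
    A of GRing.Lmodule K A & Semigroup A := {
  star : A -> A;
  samulDl : forall x y z : A, (x + y) ** z = (x ** z + y ** z);
  samulDr : forall x y z : A, z ** (x + y) = (z ** x + z ** y);
  scalesaAl : forall (k : K) (x y : A), k *: (x ** y) = (k *: x) ** y;
  scalesaAr : forall (k : K) (x y : A), k *: (x ** y) = x ** (k *: y);
  starK : involutive star;
  starD : forall x y : A, star (x + y) = (star x + star y);
  starZ : forall (k : K) (x : A), star (k *: x) = conj k *: star x;
  starM : forall x y : A, star (x ** y) = star y ** star x
}.

#[short(type="starAlgType")]
HB.structure Definition StarAlgebra (K : comNzRingType)
    (conj : involutive_rmorphism K) :=
  {A of isStarAlgebra K conj A & GRing.Lmodule K A & Semigroup A}.

Section StarAlgebraTheory.

Variables (K : comNzRingType) (conj : involutive_rmorphism K).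
Variable A : starAlgType conj.
Implicit Types x y z : A.

Local Notation star := (@star K conj A).

Lemma samul0 x : x ** 0 = 0.
Proof. by apply: (@addIr _ (x ** 0)); rewrite -samulDr !add0r. Qed.

Lemma sa0mul x : 0 ** x = 0.
Proof. by apply: (@addIr _ (0 ** x)); rewrite -samulDl !add0r. Qed.

Lemma samulNr x y : x ** (- y) = - (x ** y).
Proof. by apply: (@addIr _ (x ** y)); rewrite -samulDr !addNr samul0. Qed.

Lemma samulNl x y : (- x) ** y = - (x ** y).
Proof. by apply: (@addIr _ (x ** y)); rewrite -samulDl !addNr sa0mul. Qed.

Lemma star0 : star 0 = 0.
Proof. by apply: (@addIr _ (star 0)); rewrite -starD !add0r. Qed.

Lemma starN x : star (- x) = - star x.
Proof. by apply: (@addIr _ (star x)); rewrite -starD !addNr star0. Qed.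

Lemma starB x y : star (x - y) = (star x - star y).
Proof. by rewrite starD starN. Qed.

Lemma samulBl x y z : (x - y) ** z = (x ** z - y ** z).
Proof. by rewrite samulDl samulNl. Qed.

Lemma samulBr x y z : z ** (x - y) = (z ** x - z ** y).
Proof. by rewrite samulDr samulNr. Qed.

Inductive starsemi (G : set A) : set A :=
| starsemi_gen x : G x -> starsemi G x
| starsemi_mul x y : starsemi G x -> starsemi G y -> starsemi G (x ** y)
| starsemi_star x : starsemi G x -> starsemi G (star x).

Inductive gensemi0 (G : set A) : set A :=
| gensemi0_zero : gensemi0 G 0
| gensemi0_gen x : G x -> gensemi0 G x
| gensemi0_mul x y : gensemi0 G x -> gensemi0 G y -> gensemi0 G (x ** y).

Inductive ideal_gen (T : set A) : set A :=
| ideal_gen_in x : T x -> ideal_gen T x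
| ideal_gen_zero : ideal_gen T 0
| ideal_gen_add x y : ideal_gen T x -> ideal_gen T y -> ideal_gen T (x + y)
| ideal_gen_scale (k : K) x : ideal_gen T x -> ideal_gen T (k *: x)
| ideal_gen_mull x y : ideal_gen T y -> ideal_gen T (x ** y)
| ideal_gen_mulr x y : ideal_gen T x -> ideal_gen T (x ** y).

Definition tame_commutators (G : set A) : set A :=
  [set c | exists x y, [/\ starsemi G x, starsemi G y &
     c = (x ** star x ** (y ** star y) - y ** star y ** (x ** star x))]].

Lemma ideal_gen_opp (T : set A) x : ideal_gen T x -> ideal_gen T (- x).
Proof. by move=> Tx; rewrite -scaleN1r; apply: ideal_gen_scale. Qed.

Lemma tame_ideal_star (G : set A) x :
  ideal_gen (tame_commutators G) x -> ideal_gen (tame_commutators G) (star x).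
Proof.
elim=> {x}.
- move=> _ [x [y [Gx Gy ->]]]; apply: ideal_gen_in; exists y, x; split=> //.
  by rewrite starB !starM !starK.
- by rewrite star0; apply: ideal_gen_zero.
- by move=> x y _ IHx _ IHy; rewrite starD; apply: ideal_gen_add.
- by move=> k x _ IHx; rewrite starZ; apply: ideal_gen_scale.
- by move=> x y _ IHy; rewrite starM; apply: ideal_gen_mulr.
- by move=> x y _ IHx; rewrite starM; apply: ideal_gen_mull.
Qed.

End StarAlgebraTheory.

(* The quotient of a *-algebra [A] by the ideal generated by the commutators  *)
(* of [x x^*] and [y y^*], with [x], [y] in the *-subsemigroup of [G]         *)
Section TameQuotient.

Variables (K : comNzRingType) (conj : involutive_rmorphism K).
Variables (A : starAlgType conj) (G : set A).

Local Notation star := (@star K conj _).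
Local Notation I := (ideal_gen (tame_commutators G)).

Definition tameb (x y : A) : bool := `[< I (x - y) >].

Lemma tameb_refl : reflexive tameb.
Proof. by move=> x; apply/asboolP; rewrite subrr; apply: ideal_gen_zero. Qed.

Lemma tameb_sym : symmetric tameb.
Proof.
by move=> x y; apply/asboolP/asboolP => /ideal_gen_opp; rewrite opprB.
Qed.

Lemma tameb_trans : transitive tameb.
Proof.
move=> y x z /asboolP xy /asboolP yz; apply/asboolP.
by rewrite -[x](subrK y) -addrA; apply: ideal_gen_add.
Qed.

Canonical tame_equiv := EquivRel tameb tameb_refl tameb_sym tameb_trans.

Definition tame : Type := {eq_quot tame_equiv}.
HB.instance Definition _ := Choice.on tame.
HB.instance Definition _ := EqQuotient.on tame.

Definition tame_pi (x : A) : tame := \pi_tame x.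

Lemma tame_piP x y : tame_pi x = tame_pi y <-> I (x - y).
Proof.
split=> [/eqmodP|xy]; first by move/asboolP.
by apply/eqmodP/asboolP.
Qed.

Lemma tame_reprK (x : tame) : tame_pi (repr x) = x.
Proof. exact: reprK. Qed.

Lemma tame_repr_pi x : I (repr (tame_pi x) - x).
Proof. by apply/tame_piP; rewrite tame_reprK. Qed.

Definition tame_add (x y : tame) : tame := tame_pi (repr x + repr y).
Definition tame_opp (x : tame) : tame := tame_pi (- repr x).
Definition tame_scale (k : K) (x : tame) : tame := tame_pi (k *: repr x).
Definition tame_mul (x y : tame) : tame := tame_pi (repr x ** repr y).
Definition tame_star (x : tame) : tame := tame_pi (star (repr x)).

Lemma tame_pi_add x y : tame_add (tame_pi x) (tame_pi y) = tame_pi (x + y).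
Proof.
by apply/tame_piP; rewrite opprD addrACA; apply: ideal_gen_add;
  apply: tame_repr_pi.
Qed.

Lemma tame_pi_opp x : tame_opp (tame_pi x) = tame_pi (- x).
Proof.
by apply/tame_piP; rewrite -opprD; apply/ideal_gen_opp/tame_repr_pi.
Qed.

Lemma tame_pi_scale k x : tame_scale k (tame_pi x) = tame_pi (k *: x).
Proof.
by apply/tame_piP; rewrite -scalerBr; apply/ideal_gen_scale/tame_repr_pi.
Qed.

Lemma tame_pi_mul x y : tame_mul (tame_pi x) (tame_pi y) = tame_pi (x ** y).
Proof.
apply/tame_piP; set a := repr _; set b := repr _.
have -> : (a ** b - x ** y = (a - x) ** b + x ** (b - y)).
  by rewrite samulBl samulBr addrA subrK.
by apply: ideal_gen_add; [apply: ideal_gen_mulr | apply: ideal_gen_mull];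
  apply: tame_repr_pi.
Qed.

Lemma tame_pi_star x : tame_star (tame_pi x) = tame_pi (star x).
Proof.
by apply/tame_piP; rewrite -starB; apply/tame_ideal_star/tame_repr_pi.
Qed.

Definition tame_piE := (tame_pi_add, tame_pi_opp, tame_pi_scale, tame_pi_mul,
  tame_pi_star).

Lemma tame_addA : associative tame_add.
Proof.
move=> x y z; rewrite -[x]tame_reprK -[y]tame_reprK -[z]tame_reprK.
by rewrite !tame_piE addrA.
Qed.

Lemma tame_addC : commutative tame_add.
Proof.
by move=> x y; rewrite -[x]tame_reprK -[y]tame_reprK !tame_piE addrC.
Qed.

Lemma tame_add0 : left_id (tame_pi 0) tame_add.
Proof. by move=> x; rewrite -[x]tame_reprK !tame_piE add0r. Qed.

Lemma tame_addN : left_inverse (tame_pi 0) tame_opp tame_add.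
Proof. by move=> x; rewrite -[x]tame_reprK !tame_piE addNr. Qed.

HB.instance Definition _ :=
  GRing.isZmodule.Build tame tame_addA tame_addC tame_add0 tame_addN.

Lemma tame_addE (x y : tame) : (x + y) = tame_add x y.
Proof. by []. Qed.

Lemma tame_scaleA k l (x : tame) :
  tame_scale k (tame_scale l x) = tame_scale (k * l) x.
Proof. by rewrite -[x]tame_reprK !tame_piE scalerA. Qed.

Lemma tame_scale1 : left_id 1 tame_scale.
Proof. by move=> x; rewrite -[x]tame_reprK !tame_piE scale1r. Qed.

Lemma tame_scaleDr : right_distributive tame_scale +%R.
Proof.
move=> k x y; rewrite !tame_addE -[x]tame_reprK -[y]tame_reprK.
by rewrite !tame_piE scalerDr.
Qed.

Lemma tame_scaleDl (x : tame) :
  {morph (tame_scale^~ x) : k l / (k + l) >-> (k + l)}.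
Proof.
by move=> k l; rewrite /= !tame_addE -[x]tame_reprK !tame_piE scalerDl.
Qed.

HB.instance Definition _ := GRing.Zmodule_isLmodule.Build K tame
  tame_scaleA tame_scale1 tame_scaleDr tame_scaleDl.

Lemma tame_mulA : associative tame_mul.
Proof.
move=> x y z; rewrite -[x]tame_reprK -[y]tame_reprK -[z]tame_reprK.
by rewrite !tame_piE mulgA.
Qed.

HB.instance Definition _ := isSemigroup.Build tame tame_mulA.

Lemma tame_mulE (x y : tame) : x ** y = tame_mul x y.
Proof. by []. Qed.

Lemma tame_scaleE k (x : tame) : k *: x = tame_scale k x.
Proof. by []. Qed.

Let opE := (tame_addE, tame_mulE, tame_scaleE).

Lemma tame_mulDl (x y z : tame) : (x + y) ** z = (x ** z + y ** z).
Proof.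
rewrite !opE -[x]tame_reprK -[y]tame_reprK -[z]tame_reprK.
by rewrite !tame_piE samulDl.
Qed.

Lemma tame_mulDr (x y z : tame) : z ** (x + y) = (z ** x + z ** y).
Proof.
rewrite !opE -[x]tame_reprK -[y]tame_reprK -[z]tame_reprK.
by rewrite !tame_piE samulDr.
Qed.

Lemma tame_scaleAl k (x y : tame) : k *: (x ** y) = (k *: x) ** y.
Proof.
by rewrite !opE -[x]tame_reprK -[y]tame_reprK !tame_piE scalesaAl.
Qed.

Lemma tame_scaleAr k (x y : tame) : k *: (x ** y) = x ** (k *: y).
Proof.
by rewrite !opE -[x]tame_reprK -[y]tame_reprK !tame_piE scalesaAr.
Qed.

Lemma tame_starK : involutive tame_star.
Proof. by move=> x; rewrite -[x]tame_reprK !tame_piE starK. Qed.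

Lemma tame_starD (x y : tame) :
  tame_star (x + y) = (tame_star x + tame_star y).
Proof. by rewrite !opE -[x]tame_reprK -[y]tame_reprK !tame_piE starD. Qed.

Lemma tame_starZ k (x : tame) : tame_star (k *: x) = conj k *: tame_star x.
Proof. by rewrite !opE -[x]tame_reprK !tame_piE starZ. Qed.

Lemma tame_starM (x y : tame) :
  tame_star (x ** y) = tame_star y ** tame_star x.
Proof. by rewrite !opE -[x]tame_reprK -[y]tame_reprK !tame_piE starM. Qed.

HB.instance Definition _ := isStarAlgebra.Build K conj tame
  tame_mulDl tame_mulDr tame_scaleAl tame_scaleAr
  tame_starK tame_starD tame_starZ tame_starM.

Lemma tame_piM x y : tame_pi (x ** y) = tame_pi x ** tame_pi y.
Proof. by rewrite tame_mulE tame_pi_mul. Qed.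

Lemma tame_piS x : tame_pi (star x) = star (tame_pi x).
Proof. by rewrite -tame_pi_star. Qed.

Lemma tame_piD x y : tame_pi (x + y) = (tame_pi x + tame_pi y).
Proof. by rewrite tame_addE tame_pi_add. Qed.

Lemma tame_piZ k x : tame_pi (k *: x) = k *: tame_pi x.
Proof. by rewrite tame_scaleE tame_pi_scale. Qed.

End TameQuotient.

Inductive saterm (K X : Type) : Type :=
| SAgen of X
| SAzero
| SAopp of saterm K X
| SAadd of saterm K X & saterm K X
| SAscale of K & saterm K X
| SAmul of saterm K X & saterm K X
| SAstar of saterm K X.
Arguments SAgen K {X} _.
Arguments SAzero {K X}.

HB.instance Definition _ (K X : Type) := gen_eqMixin (saterm K X).
HB.instance Definition _ (K X : Type) := gen_choiceMixin (saterm K X).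

Section SACong.

Variables (K : comNzRingType) (conj : involutive_rmorphism K) (X : Type).
Variable R : saterm K X -> saterm K X -> Prop.

Inductive sacong : saterm K X -> saterm K X -> Prop :=
| sacong_rel a b : R a b -> sacong a b
| sacong_refl a : sacong a a
| sacong_sym a b : sacong a b -> sacong b a
| sacong_trans a b c : sacong a b -> sacong b c -> sacong a c
| sacong_opp a a' : sacong a a' -> sacong (SAopp a) (SAopp a')
| sacong_add a a' b b' :
    sacong a a' -> sacong b b' -> sacong (SAadd a b) (SAadd a' b')
| sacong_scale k a a' : sacong a a' -> sacong (SAscale k a) (SAscale k a')
| sacong_mul a a' b b' :
    sacong a a' -> sacong b b' -> sacong (SAmul a b) (SAmul a' b')
| sacong_star a a' : sacong a a' -> sacong (SAstar a) (SAstar a')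
| sacong_addA a b c : sacong (SAadd a (SAadd b c)) (SAadd (SAadd a b) c)
| sacong_addC a b : sacong (SAadd a b) (SAadd b a)
| sacong_add0 a : sacong (SAadd SAzero a) a
| sacong_addN a : sacong (SAadd (SAopp a) a) SAzero
| sacong_scaleA k l a :
    sacong (SAscale k (SAscale l a)) (SAscale (k * l) a)
| sacong_scale1 a : sacong (SAscale 1 a) a
| sacong_scaleDr k a b :
    sacong (SAscale k (SAadd a b)) (SAadd (SAscale k a) (SAscale k b))
| sacong_scaleDl k l a :
    sacong (SAscale (k + l) a) (SAadd (SAscale k a) (SAscale l a))
| sacong_mulA a b c : sacong (SAmul a (SAmul b c)) (SAmul (SAmul a b) c)
| sacong_mulDl a b c :
    sacong (SAmul (SAadd a b) c) (SAadd (SAmul a c) (SAmul b c))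
| sacong_mulDr a b c :
    sacong (SAmul c (SAadd a b)) (SAadd (SAmul c a) (SAmul c b))
| sacong_scaleAl k a b :
    sacong (SAscale k (SAmul a b)) (SAmul (SAscale k a) b)
| sacong_scaleAr k a b :
    sacong (SAscale k (SAmul a b)) (SAmul a (SAscale k b))
| sacong_starK a : sacong (SAstar (SAstar a)) a
| sacong_starD a b :
    sacong (SAstar (SAadd a b)) (SAadd (SAstar a) (SAstar b))
| sacong_starZ k a :
    sacong (SAstar (SAscale k a)) (SAscale (conj k) (SAstar a))
| sacong_starM a b :
    sacong (SAstar (SAmul a b)) (SAmul (SAstar b) (SAstar a)).

Definition sacongb (a b : saterm K X) : bool := `[< sacong a b >].

Lemma sacongb_refl : reflexive sacongb.
Proof. by move=> a; apply/asboolP/sacong_refl. Qed.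

Lemma sacongb_sym : symmetric sacongb.
Proof. by move=> a b; apply/asboolP/asboolP => /sacong_sym. Qed.

Lemma sacongb_trans : transitive sacongb.
Proof.
move=> b a c /asboolP ab /asboolP bc.
by apply/asboolP/(sacong_trans ab bc).
Qed.

Canonical sacong_equiv :=
  EquivRel sacongb sacongb_refl sacongb_sym sacongb_trans.

Definition sapres : Type := {eq_quot sacong_equiv}.
HB.instance Definition _ := Choice.on sapres.
HB.instance Definition _ := EqQuotient.on sapres.

Definition sa_pi (a : saterm K X) : sapres := \pi_sapres a.

Lemma sa_piP a b : sa_pi a = sa_pi b <-> sacong a b.
Proof.
split=> [/eqmodP|ab]; first by move/asboolP.
by apply/eqmodP/asboolP.
Qed.

Lemma sa_reprK (x : sapres) : sa_pi (repr x) = x.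
Proof. exact: reprK. Qed.

Lemma sa_repr_pi a : sacong (repr (sa_pi a)) a.
Proof. by apply/sa_piP; rewrite sa_reprK. Qed.

Definition sa_opp (x : sapres) : sapres := sa_pi (SAopp (repr x)).
Definition sa_add (x y : sapres) : sapres := sa_pi (SAadd (repr x) (repr y)).
Definition sa_scale (k : K) (x : sapres) : sapres := sa_pi (SAscale k (repr x)).
Definition sa_mul (x y : sapres) : sapres := sa_pi (SAmul (repr x) (repr y)).
Definition sa_star (x : sapres) : sapres := sa_pi (SAstar (repr x)).

Lemma sa_pi_opp a : sa_opp (sa_pi a) = sa_pi (SAopp a).
Proof. by apply/sa_piP/sacong_opp/sa_repr_pi. Qed.

Lemma sa_pi_add a b : sa_add (sa_pi a) (sa_pi b) = sa_pi (SAadd a b).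
Proof. by apply/sa_piP/sacong_add; apply: sa_repr_pi. Qed.

Lemma sa_pi_scale k a : sa_scale k (sa_pi a) = sa_pi (SAscale k a).
Proof. by apply/sa_piP/sacong_scale/sa_repr_pi. Qed.

Lemma sa_pi_mul a b : sa_mul (sa_pi a) (sa_pi b) = sa_pi (SAmul a b).
Proof. by apply/sa_piP/sacong_mul; apply: sa_repr_pi. Qed.

Lemma sa_pi_star a : sa_star (sa_pi a) = sa_pi (SAstar a).
Proof. by apply/sa_piP/sacong_star/sa_repr_pi. Qed.

Definition sa_piE := (sa_pi_opp, sa_pi_add, sa_pi_scale, sa_pi_mul, sa_pi_star).

Lemma sa_addA : associative sa_add.
Proof.
move=> x y z; rewrite -[x]sa_reprK -[y]sa_reprK -[z]sa_reprK !sa_piE.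
exact/sa_piP/sacong_addA.
Qed.

Lemma sa_addC : commutative sa_add.
Proof.
move=> x y; rewrite -[x]sa_reprK -[y]sa_reprK !sa_piE.
exact/sa_piP/sacong_addC.
Qed.

Lemma sa_add0 : left_id (sa_pi SAzero) sa_add.
Proof.
by move=> x; rewrite -[x]sa_reprK !sa_piE; apply/sa_piP/sacong_add0.
Qed.

Lemma sa_addN : left_inverse (sa_pi SAzero) sa_opp sa_add.
Proof.
by move=> x; rewrite -[x]sa_reprK !sa_piE; apply/sa_piP/sacong_addN.
Qed.

HB.instance Definition _ :=
  GRing.isZmodule.Build sapres sa_addA sa_addC sa_add0 sa_addN.

Lemma sa_addE (x y : sapres) : (x + y) = sa_add x y.
Proof. by []. Qed.

Lemma sa_scaleA k l (x : sapres) :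
  sa_scale k (sa_scale l x) = sa_scale (k * l) x.
Proof. by rewrite -[x]sa_reprK !sa_piE; apply/sa_piP/sacong_scaleA. Qed.

Lemma sa_scale1 : left_id 1 sa_scale.
Proof.
by move=> x; rewrite -[x]sa_reprK !sa_piE; apply/sa_piP/sacong_scale1.
Qed.

Lemma sa_scaleDr : right_distributive sa_scale +%R.
Proof.
move=> k x y; rewrite !sa_addE -[x]sa_reprK -[y]sa_reprK !sa_piE.
exact/sa_piP/sacong_scaleDr.
Qed.

Lemma sa_scaleDl (x : sapres) :
  {morph (sa_scale^~ x) : k l / (k + l) >-> (k + l)}.
Proof.
move=> k l; rewrite /= !sa_addE -[x]sa_reprK !sa_piE.
exact/sa_piP/sacong_scaleDl.
Qed.

HB.instance Definition _ := GRing.Zmodule_isLmodule.Build K sapres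
  sa_scaleA sa_scale1 sa_scaleDr sa_scaleDl.

Lemma sa_mulA : associative sa_mul.
Proof.
move=> x y z; rewrite -[x]sa_reprK -[y]sa_reprK -[z]sa_reprK !sa_piE.
exact/sa_piP/sacong_mulA.
Qed.

HB.instance Definition _ := isSemigroup.Build sapres sa_mulA.

Lemma sa_mulE (x y : sapres) : x ** y = sa_mul x y.
Proof. by []. Qed.

Lemma sa_scaleE k (x : sapres) : k *: x = sa_scale k x.
Proof. by []. Qed.

Let opE := (sa_addE, sa_mulE, sa_scaleE).

Lemma sa_mulDl (x y z : sapres) : (x + y) ** z = (x ** z + y ** z).
Proof.
rewrite !opE -[x]sa_reprK -[y]sa_reprK -[z]sa_reprK !sa_piE.
exact/sa_piP/sacong_mulDl.
Qed.

Lemma sa_mulDr (x y z : sapres) : z ** (x + y) = (z ** x + z ** y).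
Proof.
rewrite !opE -[x]sa_reprK -[y]sa_reprK -[z]sa_reprK !sa_piE.
exact/sa_piP/sacong_mulDr.
Qed.

Lemma sa_scaleAl k (x y : sapres) : k *: (x ** y) = (k *: x) ** y.
Proof.
rewrite !opE -[x]sa_reprK -[y]sa_reprK !sa_piE.
exact/sa_piP/sacong_scaleAl.
Qed.

Lemma sa_scaleAr k (x y : sapres) : k *: (x ** y) = x ** (k *: y).
Proof.
rewrite !opE -[x]sa_reprK -[y]sa_reprK !sa_piE.
exact/sa_piP/sacong_scaleAr.
Qed.

Lemma sa_starK : involutive sa_star.
Proof.
by move=> x; rewrite -[x]sa_reprK !sa_piE; apply/sa_piP/sacong_starK.
Qed.

Lemma sa_starD (x y : sapres) : sa_star (x + y) = (sa_star x + sa_star y).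
Proof.
rewrite !opE -[x]sa_reprK -[y]sa_reprK !sa_piE.
exact/sa_piP/sacong_starD.
Qed.

Lemma sa_starZ k (x : sapres) : sa_star (k *: x) = conj k *: sa_star x.
Proof.
by rewrite !opE -[x]sa_reprK !sa_piE; apply/sa_piP/sacong_starZ.
Qed.

Lemma sa_starM (x y : sapres) : sa_star (x ** y) = sa_star y ** sa_star x.
Proof.
rewrite !opE -[x]sa_reprK -[y]sa_reprK !sa_piE.
exact/sa_piP/sacong_starM.
Qed.

HB.instance Definition _ := isStarAlgebra.Build K conj sapres
  sa_mulDl sa_mulDr sa_scaleAl sa_scaleAr
  sa_starK sa_starD sa_starZ sa_starM.

Lemma sa_piM a b : sa_pi (SAmul a b) = sa_pi a ** sa_pi b.
Proof. by rewrite sa_mulE sa_pi_mul. Qed.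

Lemma sa_piS a : sa_pi (SAstar a) = @star K conj _ (sa_pi a).
Proof. by rewrite -sa_pi_star. Qed.

Lemma sa_piD a b : sa_pi (SAadd a b) = (sa_pi a + sa_pi b).
Proof. by rewrite sa_addE sa_pi_add. Qed.

Lemma sa_piN a : sa_pi (SAopp a) = (- sa_pi a).
Proof. by rewrite -sa_pi_opp. Qed.

Lemma sa_piZ k a : sa_pi (SAscale k a) = k *: sa_pi a.
Proof. by rewrite sa_scaleE sa_pi_scale. Qed.

Lemma sa_pi0 : sa_pi SAzero = 0.
Proof. by []. Qed.

Lemma sa_pi_rel a b : R a b -> sa_pi a = sa_pi b.
Proof. by move=> Rab; apply/sa_piP/sacong_rel. Qed.

End SACong.

Section SAUniversal.

Variables (K : comNzRingType) (conj : involutive_rmorphism K).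
Variables (X : Type) (A : starAlgType conj) (f : X -> A).

Local Notation star := (@star K conj _).

Fixpoint sa_eval (a : saterm K X) : A :=
  match a with
  | SAgen x => f x
  | SAzero => 0
  | SAopp a => - sa_eval a
  | SAadd a b => (sa_eval a + sa_eval b)
  | SAscale k a => k *: sa_eval a
  | SAmul a b => sa_eval a ** sa_eval b
  | SAstar a => star (sa_eval a)
  end.

Variable R : saterm K X -> saterm K X -> Prop.

Definition sa_lift (x : sapres conj R) : A := sa_eval (repr x).

Hypothesis fR : forall a b, R a b -> sa_eval a = sa_eval b.

Lemma sa_eval_cong a b : sacong conj R a b -> sa_eval a = sa_eval b.
Proof.
elim=> //=.
- by move=> {}a {}b c _ -> _ ->.
- by move=> {}a a' _ ->.
- by move=> {}a a' {}b b' _ -> _ ->.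
- by move=> k {}a a' _ ->.
- by move=> {}a a' {}b b' _ -> _ ->.
- by move=> {}a a' _ ->.
- by move=> *; rewrite addrA.
- by move=> *; rewrite addrC.
- by move=> *; rewrite add0r.
- by move=> *; rewrite addNr.
- by move=> *; rewrite scalerA.
- by move=> *; rewrite scale1r.
- by move=> *; rewrite scalerDr.
- by move=> *; rewrite scalerDl.
- by move=> *; rewrite mulgA.
- by move=> *; rewrite samulDl.
- by move=> *; rewrite samulDr.
- by move=> *; rewrite scalesaAl.
- by move=> *; rewrite scalesaAr.
- by move=> *; rewrite starK.
- by move=> *; rewrite starD.
- by move=> *; rewrite starZ.
- by move=> *; rewrite starM.
Qed.

Lemma sa_lift_pi a : sa_lift (sa_pi conj R a) = sa_eval a.
Proof. exact/sa_eval_cong/sa_repr_pi. Qed.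

Lemma sa_lift_gen x : sa_lift (sa_pi conj R (SAgen K x)) = f x.
Proof. exact: sa_lift_pi. Qed.

Lemma sa_liftD : {morph sa_lift : x y / (x + y)}.
Proof.
move=> x y; rewrite sa_addE -[x]sa_reprK -[y]sa_reprK sa_piE.
by rewrite !sa_lift_pi.
Qed.

Lemma sa_liftZ k : {morph sa_lift : x / k *: x}.
Proof. by move=> x; rewrite sa_scaleE -[x]sa_reprK sa_piE !sa_lift_pi. Qed.

Lemma sa_liftM : {morph sa_lift : x y / x ** y}.
Proof.
move=> x y; rewrite sa_mulE -[x]sa_reprK -[y]sa_reprK sa_piE.
by rewrite !sa_lift_pi.
Qed.

Lemma sa_liftS : {morph sa_lift : x / star x}.
Proof. by move=> x; rewrite -[x]sa_reprK -sa_piS !sa_lift_pi. Qed.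

Lemma sa_lift_uniq (g : sapres conj R -> A) :
  (forall x, g (sa_pi conj R (SAgen K x)) = f x) ->
  {morph g : x y / (x + y)} -> (forall k, {morph g : x / k *: x}) ->
  {morph g : x y / x ** y} -> {morph g : x / star x} -> g =1 sa_lift.
Proof.
move=> gX gD gZ gM gS x; rewrite -[x]sa_reprK sa_lift_pi.
have g0 : g 0 = 0 by rewrite -(scale0r 0) gZ scale0r.
elim: (repr x) => [y||a IHa|a IHa b IHb|k a IHa|a IHa b IHb|a IHa] /=.
- exact: gX.
- exact: g0.
- by rewrite sa_piN -scaleN1r gZ scaleN1r IHa.
- by rewrite sa_piD gD IHa IHb.
- by rewrite sa_piZ gZ IHa.
- by rewrite sa_piM gM IHa IHb.
- by rewrite sa_piS gS IHa.
Qed.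

End SAUniversal.
Arguments sa_lift {K conj X A} f {R} x.

(* Arbitrary sets are [choiceType]s: classically every type is one.            *)
Record sepgraph := SepGraph {
  vert : choiceType;
  edge : choiceType;
  src : edge -> vert;
  rng : edge -> vert;
  sep : vert -> set (set edge);
  sep_partition : forall v, partition (sep v) id (src @^-1` [set v])
}.

Definition sepC (E : sepgraph) : set (set (edge E)) := \bigcup_v sep v.

Inductive hatedge (E : sepgraph) : Type :=
| Fwd of edge E
| Bwd of edge E.

Definition hatsrc (E : sepgraph) (x : hatedge E) : vert E :=
  match x with Fwd e => src e | Bwd e => rng e end.

Definition hatrng (E : sepgraph) (x : hatedge E) : vert E :=
  match x with Fwd e => rng e | Bwd e => src e end.

Inductive li_gen (E : sepgraph) : Type :=
| LIv of vert E
| LIe of hatedge E.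

Section LeavittInverseSemigroup.

Variable E : sepgraph.

Local Notation tv v := (ISgen (LIv v)).
Local Notation te x := (ISgen (LIe x)).

Inductive li_rel : isterm (li_gen E) -> isterm (li_gen E) -> Prop :=
| li_rel1 v w :
    li_rel (ISmul (tv v) (tv w)) (if v == w then tv v else ISzero)
| li_rel2 x : li_rel (ISmul (tv (hatsrc x)) (te x)) (te x)
| li_rel3 x : li_rel (ISmul (te x) (tv (hatrng x))) (te x)
| li_rel4 X e f : sepC X -> X e -> X f ->
    li_rel (ISmul (te (Bwd e)) (te (Fwd f)))
           (if e == f then tv (rng e) else ISzero)
| li_rel5 e : sepC [set e] ->
    li_rel (ISmul (te (Fwd e)) (te (Bwd e))) (tv (src e)).

Definition LI : Type := ispres li_rel.
HB.instance Definition _ := InvSemigroup0.on LI.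

Definition li_of (x : li_gen E) : LI := is_pi li_rel (ISgen x).

End LeavittInverseSemigroup.

Inductive lpa_gen (E : sepgraph) : Type :=
| LPv of vert E
| LPe of edge E.

(* [K] is nonzero: over the zero ring the algebras below collapse, while the   *)
(* Leavitt inverse semigroup does not.                                        *)
Section LeavittPathAlgebra.

Variables (K : comNzRingType) (conj : involutive_rmorphism K) (E : sepgraph).

Local Notation tv v := (SAgen K (LPv v)).
Local Notation te e := (SAgen K (LPe e)).

Inductive lpa_rel : saterm K (lpa_gen E) -> saterm K (lpa_gen E) -> Prop :=
| lpa_rel_sa v : lpa_rel (SAstar (tv v)) (tv v)
| lpa_rel_vv v w :
    lpa_rel (SAmul (tv v) (tv w)) (if v == w then tv v else SAzero)
| lpa_rel_se e : lpa_rel (SAmul (tv (src e)) (te e)) (te e)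
| lpa_rel_er e : lpa_rel (SAmul (te e) (tv (rng e))) (te e)
| lpa_rel_es e :
    lpa_rel (SAmul (SAstar (te e)) (tv (src e))) (SAstar (te e))
| lpa_rel_re e :
    lpa_rel (SAmul (tv (rng e)) (SAstar (te e))) (SAstar (te e))
| lpa_rel_ef X e f : sepC X -> X e -> X f ->
    lpa_rel (SAmul (SAstar (te e)) (te f))
            (if e == f then tv (rng e) else SAzero)
| lpa_rel_sum v X : sep v X -> finite_set X ->
    lpa_rel
      (\big[@SAadd K (lpa_gen E)/SAzero]_(e <- fset_set X)
          SAmul (te e) (SAstar (te e)))
      (tv v).

Definition LPA : Type := sapres conj lpa_rel.
HB.instance Definition _ := StarAlgebra.on LPA.

Definition lpa_v (v : vert E) : LPA := sa_pi conj lpa_rel (tv v).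
Definition lpa_e (e : edge E) : LPA := sa_pi conj lpa_rel (te e).

Definition LPAab : Type := tame (range lpa_v `|` range lpa_e).
HB.instance Definition _ := StarAlgebra.on LPAab.

Definition ab_pi (x : LPA) : LPAab := tame_pi (range lpa_v `|` range lpa_e) x.
Definition ab_v (v : vert E) : LPAab := ab_pi (lpa_v v).
Definition ab_e (e : edge E) : LPAab := ab_pi (lpa_e e).

Local Notation star := (@star K conj _).

Definition lpaab_gens : set LPAab :=
  range ab_v `|` range ab_e `|` range (fun e => star (ab_e e)).

(* Zero has to be adjoined: when [E] has one vertex and no edge, no product of *)
(* generators vanishes in the algebra, whereas [LI E] contains a zero.         *)
Definition LPAsemi : Type := gensemi0 lpaab_gens.
HB.instance Definition _ := SubChoice.on LPAsemi.

Local Notation G := (range lpa_v `|` range lpa_e).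

Lemma ab_piM x y : ab_pi (x ** y) = ab_pi x ** ab_pi y.
Proof. exact: tame_piM. Qed.

Lemma ab_piS x : ab_pi (star x) = star (ab_pi x).
Proof. exact: tame_piS. Qed.

Lemma lpa_vS v : star (lpa_v v) = lpa_v v.
Proof. by rewrite -sa_piS; apply/sa_pi_rel/lpa_rel_sa. Qed.

Lemma lpa_vv v w : lpa_v v ** lpa_v w = if v == w then lpa_v v else 0.
Proof.
rewrite -sa_piM (sa_pi_rel _ (lpa_rel_vv v w)).
by case: ifP => // _; rewrite sa_pi0.
Qed.

Lemma lpa_se e : lpa_v (src e) ** lpa_e e = lpa_e e.
Proof. by rewrite -sa_piM; apply/sa_pi_rel/lpa_rel_se. Qed.

Lemma lpa_er e : lpa_e e ** lpa_v (rng e) = lpa_e e.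
Proof. by rewrite -sa_piM; apply/sa_pi_rel/lpa_rel_er. Qed.

Lemma lpa_es e : star (lpa_e e) ** lpa_v (src e) = star (lpa_e e).
Proof. by rewrite -sa_piS -sa_piM; apply/sa_pi_rel/lpa_rel_es. Qed.

Lemma lpa_re e : lpa_v (rng e) ** star (lpa_e e) = star (lpa_e e).
Proof. by rewrite -sa_piS -sa_piM; apply/sa_pi_rel/lpa_rel_re. Qed.

Lemma lpa_ef X e f : sepC X -> X e -> X f ->
  star (lpa_e e) ** lpa_e f = if e == f then lpa_v (rng e) else 0.
Proof.
move=> CX Xe Xf; rewrite -sa_piS -sa_piM (sa_pi_rel _ (lpa_rel_ef CX Xe Xf)).
by case: ifP => // _; rewrite sa_pi0.
Qed.

Lemma lpa_sum v X : sep v X -> finite_set X ->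
  \sum_(e <- fset_set X) lpa_e e ** star (lpa_e e) = lpa_v v.
Proof.
move=> CX finX; rewrite [RHS](esym (sa_pi_rel conj (lpa_rel_sum CX finX))).
elim/big_ind2: _ => [//|x a y b -> ->|e _]; first by rewrite sa_piD.
by rewrite sa_piM sa_piS.
Qed.

Lemma lpa_sepC (e : edge E) : exists2 X, sepC X & X e.
Proof.
have [cov _ _] := sep_partition (src e).
have : (@src E @^-1` [set src e]) e by [].
by rewrite -cov => -[X CX Xe]; exists X => //; exists (src e).
Qed.

Lemma ab_range_comm x y : starsemi G x -> starsemi G y ->
  ab_pi (x ** star x) ** ab_pi (y ** star y) =
  ab_pi (y ** star y) ** ab_pi (x ** star x).
Proof.
move=> Gx Gy; rewrite -!ab_piM; apply/tame_piP/ideal_gen_in.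
by exists x, y.
Qed.

Lemma ab_partial_isometry x : starsemi G x ->
  ab_pi x ** star (ab_pi x) ** ab_pi x = ab_pi x.
Proof.
elim=> {x} [_ [[v _ <-]|[e _ <-]]|x y Gx IHx Gy IHy|x Gx IHx].
- by rewrite -ab_piS -!ab_piM lpa_vS lpa_vv eqxx lpa_vv eqxx.
- have [X CX Xe] := lpa_sepC e.
  by rewrite -ab_piS -!ab_piM -mulgA (lpa_ef CX Xe Xe) eqxx lpa_er.
- have := ab_range_comm (starsemi_star Gx) Gy.
  rewrite starK !ab_piM !ab_piS => C; rewrite starM.
  set a := ab_pi x; set b := ab_pi y; rewrite -/a -/b in C IHx IHy.
  transitivity (a ** (b ** star b ** (star a ** a)) ** b).
    by rewrite !mulgA.
  rewrite -C; transitivity (a ** star a ** a ** (b ** star b ** b)).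
    by rewrite !mulgA.
  by rewrite IHx IHy.
- by rewrite ab_piS starK -[in RHS]IHx !starM starK mulgA.
Qed.

Lemma lpasemiP (x : LPAab) : gensemi0 lpaab_gens x ->
  x = 0 \/ exists2 y, starsemi G y & x = ab_pi y.
Proof.
elim=> {x} [|x Gx|x y _ IHx _ IHy]; first by left.
- right; case: Gx => [[[v _ <-]|[e _ <-]]|[e _ <-]].
  + by exists (lpa_v v) => //; apply: starsemi_gen; left; exists v.
  + by exists (lpa_e e) => //; apply: starsemi_gen; right; exists e.
  + exists (star (lpa_e e)); last by rewrite ab_piS.
    by apply/starsemi_star/starsemi_gen; right; exists e.
- case: IHx => [->|[a Ga ->]]; first by left; rewrite sa0mul.
  case: IHy => [->|[b Gb ->]]; first by left; rewrite samul0.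
  by right; exists (a ** b); [apply: starsemi_mul | rewrite ab_piM].
Qed.

Lemma lpasemi_zero : (0 : LPAab) \in gensemi0 lpaab_gens.
Proof. by rewrite inE; apply: gensemi0_zero. Qed.

Lemma lpasemi_mul (x y : LPAsemi) : val x ** val y \in gensemi0 lpaab_gens.
Proof. by rewrite inE; apply: gensemi0_mul; exact: set_valP. Qed.

Lemma lpasemi_star (x : LPAsemi) : star (val x) \in gensemi0 lpaab_gens.
Proof.
rewrite inE; elim: (set_valP x) => {x} [|x Gx|x y _ IHx _ IHy].
- by rewrite star0; apply: gensemi0_zero.
- apply: gensemi0_gen; case: Gx => [[[v _ <-]|[e _ <-]]|[e _ <-]].
  + by left; left; exists v => //; rewrite -ab_piS lpa_vS.
  + by right; exists e.
  + by left; right; exists e => //; rewrite starK.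
- by rewrite starM; apply: gensemi0_mul.
Qed.

Definition ls_sub (x : LPAab) (x_semi : x \in gensemi0 lpaab_gens) : LPAsemi :=
  exist (fun y => y \in gensemi0 lpaab_gens) x x_semi.

Definition ls_zero : LPAsemi := ls_sub lpasemi_zero.
Definition ls_mul (x y : LPAsemi) : LPAsemi := ls_sub (lpasemi_mul x y).
Definition ls_star (x : LPAsemi) : LPAsemi := ls_sub (lpasemi_star x).

Lemma ls_mulA : associative ls_mul.
Proof. by move=> x y z; apply: val_inj; rewrite /= mulgA. Qed.

HB.instance Definition _ := isSemigroup.Build LPAsemi ls_mulA.

Lemma ls_valM (x y : LPAsemi) : val (x ** y) = val x ** val y.
Proof. by []. Qed.

Lemma ls_mul0s (x : LPAsemi) : ls_zero ** x = ls_zero.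
Proof. by apply: val_inj; rewrite ls_valM sa0mul. Qed.

Lemma ls_muls0 (x : LPAsemi) : x ** ls_zero = ls_zero.
Proof. by apply: val_inj; rewrite ls_valM samul0. Qed.

Lemma ls_starK : involutive ls_star.
Proof. by move=> x; apply: val_inj; rewrite /= starK. Qed.

Lemma ls_starM (x y : LPAsemi) : ls_star (x ** y) = ls_star y ** ls_star x.
Proof. by apply: val_inj; rewrite /= starM. Qed.

Lemma ls_mulsVs (x : LPAsemi) : x ** ls_star x ** x = x.
Proof.
apply: val_inj; rewrite !ls_valM /=.
case: (lpasemiP (set_valP x)) => [->|[y Gy ->]]; first by rewrite samul0.
exact: ab_partial_isometry.
Qed.

Lemma ls_mulsVC (x y : LPAsemi) :
  x ** ls_star x ** (y ** ls_star y) = y ** ls_star y ** (x ** ls_star x).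
Proof.
apply: val_inj; rewrite !ls_valM /=.
case: (lpasemiP (set_valP x)) => [->|[a Ga ->]].
  by rewrite star0 samul0 sa0mul samul0.
case: (lpasemiP (set_valP y)) => [->|[b Gb ->]].
  by rewrite star0 samul0 sa0mul samul0.
by rewrite -!ab_piS -!(ab_piM _ (star _)) ab_range_comm.
Qed.

HB.instance Definition _ := Semigroup_isInvSemigroup0Eq.Build LPAsemi
  ls_mul0s ls_muls0 ls_starK ls_starM ls_mulsVs ls_mulsVC.

Definition li_iota_gen (x : li_gen E) : LPAab :=
  match x with
  | LIv v => ab_v v
  | LIe (Fwd e) => ab_e e
  | LIe (Bwd e) => star (ab_e e)
  end.

Lemma li_iota_gen_semi x : li_iota_gen x \in gensemi0 lpaab_gens.
Proof.
rewrite inE; apply: gensemi0_gen; case: x => [v|[e|e]].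
- by left; left; exists v.
- by left; right; exists e.
- by right; exists e.
Qed.

Definition li_iota_semi : LI E -> LPAsemi :=
  is_lift (fun x => ls_sub (li_iota_gen_semi x)).

Definition li_iota (x : LI E) : LPAab := val (li_iota_semi x).

Lemma li_iota_gen_rel a b : li_rel a b ->
  is_eval (fun x => ls_sub (li_iota_gen_semi x)) a =
  is_eval (fun x => ls_sub (li_iota_gen_semi x)) b.
Proof.
move=> ab; apply: val_inj; case: ab.
- by move=> v w /=; rewrite -ab_piM lpa_vv; case: ifP.
- by case=> e /=; rewrite -?ab_piS -ab_piM ?lpa_se ?lpa_re.
- by case=> e /=; rewrite -?ab_piS -ab_piM ?lpa_es ?lpa_er.
- move=> X e f CX Xe Xf /=.
  by rewrite -ab_piS -ab_piM (lpa_ef CX Xe Xf); case: ifP.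
- move=> e [v _ Ce] /=; rewrite -ab_piS -ab_piM.
  have -> : src e = v.
    have [cov _ _] := sep_partition v.
    have : (cover (sep v) id) e by exists [set e].
    by rewrite cov.
  by rewrite /ab_v -(lpa_sum Ce (finite_set1 e)) fset_set1 big_seq_fset1.
Qed.

Lemma li_iotaM : {morph li_iota : x y / x ** y}.
Proof. by move=> x y; rewrite /li_iota /li_iota_semi (is_liftM li_iota_gen_rel). Qed.

Lemma li_iota0 : li_iota szero = 0.
Proof. by rewrite /li_iota /li_iota_semi (is_lift0 li_iota_gen_rel). Qed.

Lemma li_iota_v v : li_iota (li_of (LIv v)) = ab_v v.
Proof. by rewrite /li_iota /li_iota_semi (is_lift_gen li_iota_gen_rel). Qed.

Lemma li_iota_e e : li_iota (li_of (LIe (Fwd e))) = ab_e e.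
Proof. by rewrite /li_iota /li_iota_semi (is_lift_gen li_iota_gen_rel). Qed.

Lemma li_iota_einv e : li_iota (li_of (LIe (Bwd e))) = star (ab_e e).
Proof. by rewrite /li_iota /li_iota_semi (is_lift_gen li_iota_gen_rel). Qed.

End LeavittPathAlgebra.

(* Main.v *)
(* LI acts on its nonzero elements by left multiplication (the Wagner-Preston  *)
(* representation), faithfully, and the relations of the tame algebra only     *)
(* fail there because the ranges of the edges of a block X of C_v need not     *)
(* cover the points at v.  Adding to each vertex one and the same large        *)
(* infinite set N of new points repairs this: for each block X separately, any *)
(* bijection between X x N and the uncovered points at v, new ones included,   *)
(* extends the action of the edges of X so that it covers.  The resulting      *)
(* partial bijections act by pullback on K-valued functions, which represents  *)
(* the tame algebra.                                                           *)
(* Assume that s and t are nonzero and have the same image, and put            *)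
(* x = s^-1 s, so that s maps x to s.  If t^-1 t x = x, then t maps x to t x,  *)
(* hence t x = s, that is s <= t in the natural order.  Otherwise a word of t  *)
(* leaves LI at some point z through an inverse edge e^-1 with e e^-1 z <> z;  *)
(* if z starts at the source of e, relation (5) shows that e is not alone in   *)
(* its block, so the bijection for that block can be chosen such that z is not *)
(* in the range of e.  Then t is undefined at x while s is not, a              *)
(* contradiction.  By symmetry s = t.                                          *)

From HB Require Import structures.
Require Import Defs.
From mathcomp Require Import all_boot all_order all_algebra sesquilinear.
From mathcomp Require Import finmap all_classical.

Set Implicit Arguments.
Unset Strict Implicit.
Unset Printing Implicit Defensive.

Import GRing.Theory.

Local Open Scope classical_set_scope.
Local Open Scope card_scope.
Local Open Scope ring_scope.

(** Equal elements of the tame algebra act alike wherever the edges of each block act as partial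
    injections whose disjoint ranges cover the points at their vertex. [LI E] acting on itself lacks
    only the covering. New points restore it block by block, with freedom of choice ([ex_filling],
    [ex_complete]); every such action represents the tame algebra ([rep_tame]), and partial
    bijections can be read off their operators ([dpull_inj]). Let [s] and [t] be nonzero with the
    same image, and [x = s^-1 s]. Under every filling the words of [s] and [t] agree at [x], where
    that of [s] is defined ([rword_source]). If [t^-1 t x <> x], some filling leaves the word of [t]
    undefined at [x] ([rword_undefined]). Hence [t x = s], that is [s <= t] in the natural order
    ([li_iota_le]), and by symmetry [s = t]. *)

(** * Partial bijections as relations *)

Section PartialBijection.

Variable O : Type.
Implicit Types R S : O -> O -> Prop.

Definition pbij R :=
  (forall x y z, R x y -> R x z -> y = z) /\
  (forall x y z, R x z -> R y z -> x = y).

Definition conv R : O -> O -> Prop := fun x y => R y x.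

Definition rcomp R S : O -> O -> Prop := fun x z => exists2 y, R x y & S y z.

Definition rempty : O -> O -> Prop := fun _ _ => False.

Lemma rel_ext R S : (forall x y, R x y <-> S x y) -> R = S.
Proof. by move=> RS; apply/funext => x; apply/funext => y; apply/propext. Qed.

Lemma pbij_conv R : pbij R -> pbij (conv R).
Proof. by case=> f i; split=> x y z; [apply: i | apply: f]. Qed.

Lemma pbij_comp R S : pbij R -> pbij S -> pbij (rcomp R S).
Proof.
move=> [Rf Ri] [Sf Si]; split=> x y z [a xa ay] [b xb bz].
  by move: bz; rewrite -(Rf _ _ _ xa xb); apply: Sf.
by move: xb; rewrite -(Si _ _ _ ay bz); apply: Ri.
Qed.

Lemma pbij_empty : pbij rempty.
Proof. by []. Qed.

Lemma conv_comp R S : conv (rcomp R S) = rcomp (conv S) (conv R).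
Proof. by apply: rel_ext => x y; split=> -[z ? ?]; exists z. Qed.

Lemma comp_convP R x y : pbij R ->
  rcomp R (conv R) x y <-> x = y /\ exists z, R x z.
Proof.
move=> [_ Ri]; split=> [[z xz yz]|[<- [z xz]]]; last by exists z.
by split; [apply: Ri xz yz | exists z].
Qed.

Lemma comp_conv_comm R S : pbij R -> pbij S ->
  rcomp (rcomp R (conv R)) (rcomp S (conv S)) =
  rcomp (rcomp S (conv S)) (rcomp R (conv R)).
Proof.
move=> bR bS; apply: rel_ext => x y; split=> -[z].
  move=> /(comp_convP _ _ bR)[<- [u xu]] /(comp_convP _ _ bS)[<- [w xw]].
  by exists x; apply/comp_convP => //; split=> //; [exists w | exists u].
move=> /(comp_convP _ _ bS)[<- [u xu]] /(comp_convP _ _ bR)[<- [w xw]].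
by exists x; apply/comp_convP => //; split=> //; [exists w | exists u].
Qed.

End PartialBijection.
Arguments rempty {O}.

(** * The star-algebra of operators with a formal adjoint *)

Section OperatorAlgebra.

Variables (K : comNzRingType) (conj : involutive_rmorphism K) (O : Type).

Local Notation V := (O -> K^o).

Definition linop_pred : {pred V -> V} := fun f => `[< linear f >].

Lemma linop_closed : submod_closed linop_pred.
Proof.
split=> [|k f g /asboolP fL /asboolP gL]; apply/asboolP => a u v.
  by rewrite /= scaler0 addr0.
have E x : (k *: f + g) x = k *: f x + g x by [].
by rewrite !E fL gL !scalerDr !scalerA mulrC addrACA.
Qed.

HB.instance Definition _ :=
  GRing.isSubmodClosed.Build K (V -> V) linop_pred linop_closed.

Definition linop : Type := {f : V -> V | linop_pred f}.
HB.instance Definition _ := SubChoice.on linop.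
HB.instance Definition _ := [SubChoice_isSubLmodule of linop by <:].

Definition mklin (f : V -> V) (fL : linear f) : linop :=
  exist (fun g => linop_pred g) f (asboolT fL).

Definition lapp (f : linop) : V -> V := val f.

Lemma linopP (f : linop) a u v : lapp f (a *: u + v) = a *: lapp f u + lapp f v.
Proof. by have /asboolP := valP f; apply. Qed.

Lemma comp_linear (f g : linop) : linear (lapp f \o lapp g).
Proof. by move=> a u v; rewrite /= !linopP. Qed.

Definition lcomp (f g : linop) : linop := mklin (comp_linear f g).

Definition vconj (u : V) : V := fun x => conj (u x).

Lemma vconjK : involutive vconj.
Proof. by move=> u; apply/funext => x; rewrite /vconj rmorphK. Qed.

Lemma vconjP a u v : vconj (a *: u + v) = conj a *: vconj u + vconj v.
Proof. by apply/funext => x; rewrite /vconj rmorphD rmorphM. Qed.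

Lemma conj_linear (f : linop) : linear (vconj \o lapp f \o vconj).
Proof. by move=> a u v; rewrite /= vconjP linopP vconjP rmorphK. Qed.

(** Conjugating both input and output keeps the operator linear and turns a scalar factor [k] into
    [conj k], as [starZ] demands. *)
Definition lconj (f : linop) : linop := mklin (conj_linear f).

(* Pairs [(f, g)], where [g] plays the role of the adjoint of [f]: this makes  *)
(* sense on all functions [O -> K], with no finiteness condition.             *)
Definition dop : Type := (linop * linop)%type.
HB.instance Definition _ := GRing.Lmodule.on dop.

Definition dop_mul (x y : dop) : dop := (lcomp x.1 y.1, lcomp y.2 x.2).
Definition dop_star (x : dop) : dop := (lconj x.2, lconj x.1).

Lemma dopP (x y : dop) :
  lapp x.1 =1 lapp y.1 -> lapp x.2 =1 lapp y.2 -> x = y.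
Proof.
case: x y => [f g] [f' g'] /= /funext E1 /funext E2.
by congr (_, _); apply: val_inj.
Qed.

Lemma dop_mulA : associative dop_mul.
Proof. by move=> x y z; apply: dopP. Qed.

HB.instance Definition _ := isSemigroup.Build dop dop_mulA.

Lemma linopD (f : linop) u v : lapp f (u + v) = lapp f u + lapp f v.
Proof. by rewrite -{1}[u]scale1r linopP scale1r. Qed.

Lemma linop0 (f : linop) : lapp f 0 = 0.
Proof. by apply: (addIr (lapp f 0)); rewrite -linopD !add0r. Qed.

Lemma linopZ (f : linop) k u : lapp f (k *: u) = k *: lapp f u.
Proof. by rewrite -[_ *: u]addr0 linopP linop0 addr0. Qed.

Lemma vconjD u v : vconj (u + v) = vconj u + vconj v.
Proof. by apply/funext => x; rewrite /vconj rmorphD. Qed.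

Lemma vconjZ k u : vconj (k *: u) = conj k *: vconj u.
Proof. by apply/funext => x; rewrite /vconj rmorphM. Qed.

Lemma dop_mulE (x y : dop) : x ** y = dop_mul x y.
Proof. by []. Qed.

Lemma lappD (f g : linop) u : lapp (f + g) u = lapp f u + lapp g u.
Proof. by []. Qed.

Lemma lappZ k (f : linop) u : lapp (k *: f) u = k *: lapp f u.
Proof. by []. Qed.

Lemma lapp_comp (f g : linop) u : lapp (lcomp f g) u = lapp f (lapp g u).
Proof. by []. Qed.

Lemma lapp_conj (f : linop) u : lapp (lconj f) u = vconj (lapp f (vconj u)).
Proof. by []. Qed.

Lemma dop_mulDl (x y z : dop) : (x + y) ** z = x ** z + y ** z.
Proof.
apply: dopP => u; rewrite !dop_mulE ?lappD ?lapp_comp ?lappD //.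
by rewrite -linopD.
Qed.

Lemma dop_mulDr (x y z : dop) : z ** (x + y) = z ** x + z ** y.
Proof.
apply: dopP => u; rewrite !dop_mulE ?lappD ?lapp_comp ?lappD //.
by rewrite -linopD.
Qed.

Lemma dop_scaleAl k (x y : dop) : k *: (x ** y) = (k *: x) ** y.
Proof.
apply: dopP => u; rewrite !dop_mulE ?lappZ ?lapp_comp ?lappZ //.
by rewrite -linopZ.
Qed.

Lemma dop_scaleAr k (x y : dop) : k *: (x ** y) = x ** (k *: y).
Proof.
apply: dopP => u; rewrite !dop_mulE ?lappZ ?lapp_comp ?lappZ //.
by rewrite -linopZ.
Qed.

Lemma dop_starK : involutive dop_star.
Proof. by move=> x; apply: dopP => u; rewrite !lapp_conj !vconjK. Qed.

Lemma dop_starD (x y : dop) : dop_star (x + y) = dop_star x + dop_star y.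
Proof. by apply: dopP => u; rewrite /= lappD !lapp_conj lappD vconjD. Qed.

Lemma dop_starZ k (x : dop) : dop_star (k *: x) = conj k *: dop_star x.
Proof. by apply: dopP => u; rewrite /= lappZ !lapp_conj lappZ vconjZ. Qed.

Lemma dop_starM (x y : dop) :
  dop_star (x ** y) = dop_star y ** dop_star x.
Proof.
by apply: dopP => u; rewrite !dop_mulE /= !(lapp_comp, lapp_conj) vconjK.
Qed.

HB.instance Definition _ := isStarAlgebra.Build K conj dop
  dop_mulDl dop_mulDr dop_scaleAl dop_scaleAr
  dop_starK dop_starD dop_starZ dop_starM.

(** Extension by zero outside the domain of [R]. For functional [R] the chosen point is the only
    one. *)
Definition pullback (R : O -> O -> Prop) (u : V) : V := fun x =>
  match pselect (exists y, R x y) with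
  | left h => u (projT1 (cid h))
  | right _ => 0
  end.

Lemma pullbackE R u x y : pbij R -> R x y -> pullback R u x = u y.
Proof.
rewrite /pullback => bR xy; case: pselect => [h|[]]; last by exists y.
by congr u; case: (cid h) => z /= xz; apply: (proj1 bR) xz xy.
Qed.

Lemma pullbackN R u x : (forall y, ~ R x y) -> pullback R u x = 0.
Proof. by rewrite /pullback => xN; case: pselect => // -[y xy]; case: (xN y). Qed.

Lemma pullback_linear R : linear (pullback R).
Proof.
move=> a u v; apply/funext => x; rewrite /pullback.
have -> (f g : V) : (a *: f + g) x = a *: f x + g x by [].
by case: pselect => // _; rewrite scaler0 addr0.
Qed.

Definition dpull (R : O -> O -> Prop) : dop :=
  (mklin (pullback_linear R), mklin (pullback_linear (conv R))).

Lemma pullback_comp R S u : pbij R -> pbij S ->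
  pullback R (pullback S u) = pullback (rcomp R S) u.
Proof.
move=> bR bS; have bRS := pbij_comp bR bS; apply/funext => x.
have [[y xy]|xN] := pselect (exists y, R x y); last first.
  rewrite !pullbackN // => y; last by move=> xy; apply: xN; exists y.
  by case=> z xz _; apply: xN; exists z.
rewrite (pullbackE _ bR xy).
have [[z yz]|yN] := pselect (exists z, S y z).
  by rewrite (pullbackE _ bS yz) (@pullbackE _ _ x z) //; exists y.
rewrite !pullbackN // => z; last by move=> yz; apply: yN; exists z.
by case=> t xt tz; case: yN; exists z; rewrite (proj1 bR _ _ _ xy xt).
Qed.

Lemma dpull_comp R S : pbij R -> pbij S ->
  dpull R ** dpull S = dpull (rcomp R S).
Proof.
move=> bR bS; apply: dopP => u; first exact: pullback_comp.
by rewrite /= conv_comp; apply: pullback_comp; apply: pbij_conv.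
Qed.

Lemma pullback_conj R u : vconj (pullback R (vconj u)) = pullback R u.
Proof.
apply/funext => x; rewrite /vconj /pullback.
by case: pselect => *; rewrite ?rmorphK ?rmorph0.
Qed.

Lemma dpull_star R : star (dpull R) = dpull (conv R).
Proof. by apply: dopP => u; apply: pullback_conj. Qed.

Lemma dpull_empty : dpull rempty = 0.
Proof. by apply: dopP => u; apply/funext => x; apply: pullbackN => y []. Qed.

Lemma dpull_inj R S : pbij R -> pbij S -> dpull R = dpull S -> R = S.
Proof.
suff sub R' S' : pbij R' -> pbij S' -> dpull R' = dpull S' ->
    forall x y, R' x y -> S' x y.
  by move=> bR bS RS; apply: rel_ext => x y; split; apply: sub.
(* The indicator function of [y] detects whether [x] is related to [y], since [1 <> 0] in [K]. *)
move=> bR bS RS x y xy; pose u : V := fun z => if `[< z = y >] then 1 else 0.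
have : pullback R' u x = 1.
  by rewrite (pullbackE _ bR xy) /u; case: asboolP.
have -> : pullback R' u = pullback S' u.
  exact: (congr1 (fun d : dop => lapp d.1 u) RS).
have [[z xz]|xN] := pselect (exists z, S' x z).
  rewrite (pullbackE _ bS xz) /u; case: asboolP => [<- //|_ /eqP].
  by rewrite eq_sym oner_eq0.
rewrite pullbackN => [/eqP|z xz]; first by rewrite eq_sym oner_eq0.
by apply: xN; exists z.
Qed.

Definition diag (P : set O) : O -> O -> Prop := fun x y => x = y /\ P x.

Lemma pbij_diag P : pbij (diag P).
Proof. by split=> x y z [-> _] [-> _]. Qed.

Lemma conv_diag P : conv (diag P) = diag P.
Proof. by apply: rel_ext => x y; split=> -[-> ?]. Qed.

Lemma pullback_diag P u x :
  pullback (diag P) u x = if `[< P x >] then u x else 0.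
Proof.
case: asboolP => Px; first by apply: pullbackE (pbij_diag P) _.
by apply: pullbackN => y [].
Qed.

Lemma dpull_diagU P Q : P `&` Q = set0 ->
  dpull (diag P) + dpull (diag Q) = dpull (diag (P `|` Q)).
Proof.
move=> PQ.
have E u : pullback (diag P) u + pullback (diag Q) u =
           pullback (diag (P `|` Q)) u.
  apply/funext => x; rewrite addrfctE !pullback_diag.
  case: (asboolP (P x)) => Px; case: (asboolP (Q x)) => Qx.
  - by have : set0 x by rewrite -PQ.
  - by rewrite asboolT ?addr0; [|left].
  - by rewrite asboolT ?add0r; [|right].
  - by rewrite asboolF ?addr0; [|case].
by apply: dopP => u; rewrite /= ?conv_diag; apply: E.
Qed.

(** Reduces the relation [lpa_rel_sum] to a statement on sets: the ranges of the edges of a block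
    are disjoint and cover the points at [v]. *)
Lemma dpull_diag_sum (I : eqType) (P : I -> set O) (r : seq I) : uniq r ->
  {in r &, forall i j, i != j -> P i `&` P j = set0} ->
  \sum_(i <- r) dpull (diag (P i)) =
  dpull (diag [set x | exists2 i, i \in r & P i x]).
Proof.
elim: r => [_ _|i r IHr /= /andP[ir ur] dP].
  rewrite big_nil -dpull_empty; congr dpull; apply: rel_ext => x y.
  by split=> // -[_ []].
rewrite big_cons IHr // => [|j k jr kr]; last first.
  by apply: dP; rewrite inE ?jr ?kr orbT.
rewrite dpull_diagU.
  congr (dpull (diag _)); apply/seteqP; split=> x /=.
    case=> [Px|[j jr Px]]; first by exists i; rewrite ?mem_head.
    by exists j; rewrite // inE jr orbT.
  case=> j; rewrite inE => /orP[/eqP ->|jr] Px; first by left.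
  by right; exists j.
rewrite -subset0 => x [Pi [j jr Pj]].
have <- : P i `&` P j = set0 by [rewrite dP ?mem_head ?inE ?jr ?orbT //;
  apply: contraNneq ir => ->].
by [].
Qed.

End OperatorAlgebra.

(** * Vertices and words in the Leavitt inverse semigroup *)

Section LeavittInverseSemigroupTheory.

Variable E : sepgraph.
Implicit Types (e f : edge E) (u v w : vert E) (X : set (edge E)) (x y s : LI E).

Local Notation lv v := (li_of (LIv v)).
Local Notation le e := (li_of (LIe (Fwd e))).
Local Notation le' e := (li_of (LIe (Bwd e))).
Local Notation pinv := (@Defs.pinv _).

Lemma li_vv v w : lv v ** lv w = if v == w then lv v else szero.
Proof.
rewrite is_mulE is_pi_mul; have /iscong_rel/is_piP -> := li_rel1 v w.
by case: ifP.
Qed.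

Lemma li_src (h : hatedge E) : lv (hatsrc h) ** li_of (LIe h) = li_of (LIe h).
Proof. by rewrite is_mulE is_pi_mul; apply/is_piP/iscong_rel/li_rel2. Qed.

Lemma li_rng (h : hatedge E) : li_of (LIe h) ** lv (hatrng h) = li_of (LIe h).
Proof. by rewrite is_mulE is_pi_mul; apply/is_piP/iscong_rel/li_rel3. Qed.

Lemma li_ef v X e f : sep v X -> X e -> X f ->
  le' e ** le f = if e == f then lv (rng e) else szero.
Proof.
move=> vX Xe Xf; have CX : sepC X by exists v.
rewrite is_mulE is_pi_mul; have /iscong_rel/is_piP -> := li_rel4 CX Xe Xf.
by case: ifP.
Qed.

Lemma li_single v e : sep v [set e] -> le e ** le' e = lv (src e).
Proof.
move=> ve; rewrite is_mulE is_pi_mul; apply/is_piP/iscong_rel/li_rel5.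
by exists v.
Qed.

Lemma sep_src v X e : sep v X -> X e -> src e = v.
Proof.
move=> vX Xe; have [cov _ _] := sep_partition v.
have : (cover (sep v) id) e by exists X.
by rewrite cov.
Qed.

Lemma ex_block e : exists X, sep (src e) X /\ X e.
Proof.
have [cov _ _] := sep_partition (src e).
have : (@src E @^-1` [set src e]) e by [].
by rewrite -cov => -[X vX Xe]; exists X.
Qed.

Definition block e : set (edge E) := projT1 (cid (ex_block e)).

Lemma blockP e : sep (src e) (block e) /\ block e e.
Proof. by rewrite /block; case: cid. Qed.

Lemma block_uniq v X e : sep v X -> X e -> block e = X.
Proof.
move=> vX Xe; have [bX be] := blockP e.
rewrite (sep_src vX Xe) in bX; have [_ triv _] := sep_partition v.
by apply: triv => //; exists e.
Qed.

Lemma li_e'e e : le' e ** le e = lv (rng e).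
Proof. by have [bX be] := blockP e; rewrite (li_ef bX be be) eqxx. Qed.

Lemma pinv_e e : pinv (le e) = le' e.
Proof.
symmetry; apply: pinv_uniq.
  by rewrite -mulgA li_e'e (li_rng (Fwd e)).
by rewrite li_e'e (li_src (Bwd e)).
Qed.

Lemma pinv_e' e : pinv (le' e) = le e.
Proof. by rewrite -pinv_e pinv_mulsVs_pinv. Qed.

Lemma pinv_v v : pinv (lv v) = lv v.
Proof. by apply: pinv_idem; rewrite li_vv eqxx. Qed.

Lemma vert_uniq u v x : x <> szero -> lv u ** x = x -> lv v ** x = x -> u = v.
Proof.
move=> x0 ux vx; apply/eqP/negP => /negP/negPf uv; apply: x0.
by rewrite -ux -vx mulgA li_vv uv mul0s.
Qed.

Definition lword (c : seq (li_gen E)) v : LI E :=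
  foldr (fun g y => li_of g ** y) (lv v) c.

Definition isword s := s = szero \/ exists c v, s = lword c v.

Lemma isword_genM g s : isword s -> isword (li_of g ** s).
Proof.
case=> [->|[c [v ->]]]; first by left; rewrite muls0.
by right; exists (g :: c), v.
Qed.

Lemma isword_gen g : isword (li_of g).
Proof.
case: g => [v|h]; first by right; exists [::], v.
by right; exists [:: LIe h], (hatrng h); rewrite /= li_rng.
Qed.

Lemma iswordM s x : isword s -> isword x -> isword (s ** x).
Proof.
case=> [->|[c [v ->]]] xw; first by left; rewrite mul0s.
elim: c => [|g c IHc] /=; first exact: isword_genM.
by rewrite -mulgA; apply: isword_genM.
Qed.

Lemma isword_pinv s : isword s -> isword (pinv s).
Proof.
case=> [->|[c [v ->]]].
  by left; apply: pinv_idem; rewrite muls0.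
elim: c => [|g c IHc] /=; first by rewrite pinv_v; apply: isword_gen.
rewrite pinv_mul; apply: iswordM => //.
case: g => [u|[e|e]]; rewrite ?pinv_v ?pinv_e ?pinv_e'; exact: isword_gen.
Qed.

(** Words suffice because the inverse of a generator is again a generator. *)
Lemma iswordP s : isword s.
Proof.
rewrite -[s]is_reprK; elim: (repr s) => [g||a IHa b IHb|a IHa].
- exact: isword_gen.
- by left.
- by rewrite -is_pi_mul; apply: iswordM.
- by rewrite -is_pi_inv; apply: isword_pinv.
Qed.

Lemma ex_vert x : x <> szero -> exists v, lv v ** x = x.
Proof.
case: (iswordP x) => [//|[[|[u|h] c] [v ->]] _] /=.
- by exists v; rewrite li_vv eqxx.
- by exists u; rewrite mulgA li_vv eqxx.
- by exists (hatsrc h); rewrite mulgA li_src.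
Qed.

(** If a product is defined at [y], so are its factors in turn, because the idempotents [s^-1 s] and
    [x x^-1] commute. This allows following a word letter by letter. *)
Lemma pinv_mul_fix s x y : pinv (s ** x) ** (s ** x ** y) = y ->
  pinv x ** (x ** y) = y /\ pinv s ** (s ** (x ** y)) = x ** y.
Proof.
rewrite pinv_mul -!mulgA => fixy; split.
  by rewrite -[in RHS]fixy -[X in _ ** (_ ** X) = _]fixy !mulgA mulVsV.
have C := idem_comm (pinv_source_idem s) (pinv_range_idem x).
have xyE : x ** (pinv x ** (x ** y)) = x ** y by rewrite !mulgA mulsVs.
transitivity (pinv s ** s ** (x ** pinv x) ** (x ** y)).
  by rewrite -!mulgA xyE.
by rewrite C -!mulgA fixy.
Qed.

(** * Configurations and complete actions of the edges *)

(** The new points are lists over edges and elements of [LI E], so that prefixing a letter injects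
    all the sets to be compared into them. *)
Definition cfg : Type := (LI E + seq (edge E + LI E))%type.
HB.instance Definition _ := gen_eqMixin cfg.
HB.instance Definition _ := gen_choiceMixin cfg.
HB.instance Definition _ := isPointed.Build cfg (inl szero).

(** A new point lies at every vertex; this is why the points acted on below are pairs of a vertex
    and a configuration. *)
Definition dom v (y : cfg) : Prop :=
  match y with inl x => x <> szero /\ lv v ** x = x | inr _ => True end.

Definition extra v X (y : cfg) : Prop :=
  dom v y /\ forall e x, X e -> dom (rng e) (inl x) -> y <> inl (le e ** x).

Lemma card_le_inj (A B : Type) (P : set A) (Q : set B) (f : A -> B) :
  set_fun P Q f -> set_inj P f -> P #<= Q.
Proof.
move=> Pf If; have /injfunPex[g] : exists2 g : A -> B, set_fun P Q g & set_inj P g.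
  by exists f.
exact: inj_card_le g.
Qed.

(** Cantor-Bernstein gives the bijection. The option [o] names an edge [e] and a point [x] to be
    kept out of the image of [e]; a second edge of the block can take [x] over. *)
Lemma ex_filling v X (o : option (edge E * LI E)) : sep v X ->
  exists g : edge E * seq (edge E + LI E) -> cfg,
    set_bij [set p | X p.1] (extra v X) g /\
    forall e x, o = Some (e, x) -> X e -> X <> [set e] ->
      forall n, g (e, n) <> inl x.
Proof.
move=> vX.
have [e0 Xe0] : exists e, X e by have [_ _] := sep_partition v; apply.
have /card_set_bijP[g gb] : [set p : edge E * seq (edge E + LI E) | X p.1] #=
    extra v X.
  apply: Cantor_Bernstein.
    apply: (@card_le_inj _ _ _ _ (fun p => inr (inl p.1 :: p.2))).
      by move=> p /= Xp; split.
    by move=> [e n] [f m] _ _ [-> ->].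
  (* The head letter, [inr] or [inl], separates old points from new ones. *)
  apply: (@card_le_inj _ _ _ _ (fun y : cfg => match y with
    inl x => (e0, [:: inr x]) | inr n => (e0, inl e0 :: n) end)).
    by case.
  by move=> [x|n] [z|m] _ _ //= [->].
case: o => [[e x]|]; last by exists g; split.
have [[n [Xe gen]]|Ne] := pselect (exists n, X e /\ g (e, n) = inl x); last first.
  by exists g; split=> // e' x' [<- <-] Xe _ n gn; apply: Ne; exists n.
have [Xs|Xs] := pselect (X = [set e]).
  by exists g; split=> // e' x' [<- _] _ [].
have [f Xf fe] : exists2 f, X f & f != e.
  apply: contra_notP Xs => XN; apply/seteqP; split=> [f Xf|f ->] //=.
  by apply/eqP/negP => /negP fe; apply: XN; exists f.
(* Only [(e, n)] hits [x]; after exchanging [e] and [f], only [(f, n)] does. *)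
pose sw e' := if e' == e then f else if e' == f then e else e'.
have swK : involutive sw.
  rewrite /sw => d; case: (eqVneq d e) => [->|de].
    by rewrite (negPf fe) eqxx.
  by case: (eqVneq d f) => [->|df]; rewrite ?eqxx // (negPf de) (negPf df).
have Xsw d : X d -> X (sw d) by rewrite /sw; do 2!case: ifP => //.
have [gf gi gs] := gb.
exists (fun p => g (sw p.1, p.2)); split.
  split.
  - by move=> [d m] /= Xd; apply: gf; apply: Xsw.
  - move=> [d m] [d' m'] /set_mem /= Xd /set_mem /= Xd' /gi.
    rewrite !inE /= => /(_ (Xsw _ Xd) (Xsw _ Xd')) [/(can_inj swK) -> ->].
    by [].
  - move=> y /gs[[d m] /= Xd <-]; exists (sw d, m) => /=; first exact: Xsw.
    by rewrite swK.
move=> _ _ [<- <-] _ _ m /=; rewrite {1}/sw eqxx -gen => /gi.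
rewrite !inE /= => /(_ Xf Xe) [fE].
by rewrite fE eqxx in fe.
Qed.

(** The third clause encodes [e^-1 f = 0] for distinct edges of a block and the injectivity of each
    edge; the fourth encodes the sum relation. *)
Definition complete (a : edge E -> cfg -> cfg) :=
  [/\ forall e x, a e (inl x) = inl (le e ** x),
      forall e (y : cfg), dom (rng e) y -> dom (src e) (a e y),
      forall v X e f (y z : cfg), sep v X -> X e -> X f -> dom (rng e) y ->
        dom (rng f) z -> a e y = a f z -> e = f /\ y = z &
      forall v X (y : cfg), sep v X -> dom v y ->
        exists e z, [/\ X e, dom (rng e) z & a e z = y]].

Lemma domM e x : dom (rng e) (inl x) -> dom (src e) (inl (le e ** x)).
Proof.
case=> x0 rx; split; last by rewrite mulgA (li_src (Fwd e)).
by move=> ex0; apply: x0; rewrite -rx -li_e'e -mulgA ex0 muls0.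
Qed.

(** Each edge lies in exactly one block, so the blocks can be filled independently of each other. *)
Lemma ex_complete (o : option (edge E * LI E)) : exists2 a, complete a &
  forall e x, o = Some (e, x) -> block e <> [set e] ->
    le e ** (le' e ** x) <> x -> forall y : cfg, dom (rng e) y -> a e y <> inl x.
Proof.
pose ok X g := forall v, sep v X -> set_bij [set p | X p.1] (extra v X) g /\
    forall e x, o = Some (e, x) -> X e -> X <> [set e] ->
      forall n : seq (edge E + LI E), g (e, n) <> inl x.
have /choice[G GP] : forall X, exists g, ok X g.
  (* A nonempty block determines its vertex; on sets that are not blocks the map is arbitrary. *)
  move=> X; have [[v vX]|XN] := pselect (exists v, sep v X); last first.
    by exists (fun=> inl szero) => v vX; case: XN; exists v.
  have [g [gb go]] := ex_filling o vX; exists g => u uX.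
  suff -> : u = v by [].
  have [e Xe] : exists e, X e by have [_ _] := sep_partition v; apply.
  by rewrite -(sep_src uX Xe) (sep_src vX Xe).
pose a e (y : cfg) : cfg :=
  match y with inl x => inl (le e ** x) | inr n => G (block e) (e, n) end.
have aE v X e n : sep v X -> X e -> a e (inr n) = G X (e, n).
  by move=> vX Xe; rewrite /= (block_uniq vX Xe).
exists a; last first.
  (* An old point [z] with [e z = x] would give [e e^-1 x = x], against [eN]. *)
  move=> e x oE bN eN [z [_ rz] [zx]|n _].
    by apply: eN; rewrite -zx [le' e ** _]mulgA li_e'e rz.
  have [bX be] := blockP e.
  by have [_ /(_ e x oE be bN n)] := GP _ _ bX.
split=> //.
- move=> e [x|n] // dy; first exact: domM.
  have [bX be] := blockP e; have [[Gf _ _] _] := GP _ _ bX.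
  by have [] := Gf (e, n) be.
- move=> v X e f y z vX Xe Xf; have [[Gf Gi _] _] := GP _ _ vX.
  case: y z => [x|n] [z|m].
  + move=> [x0 rx] [z0 rz] [exz].
    have ef : e = f.
      apply/eqP/negP => /negP/negPf ef; apply: x0.
      by rewrite -rx -li_e'e -mulgA exz mulgA (li_ef vX Xe Xf) ef mul0s.
    subst f; have -> : x = z; last by split.
    by rewrite -rx -rz -li_e'e -!mulgA exz.
  + move=> dx _; rewrite (aE _ _ _ _ vX Xf) => exz.
    by have [_ /(_ e x Xe dx (esym exz))] := Gf (f, m) Xf.
  + move=> _ dz; rewrite (aE _ _ _ _ vX Xe) => exz.
    by have [_ /(_ f z Xf dz exz)] := Gf (e, n) Xe.
  + move=> _ _; rewrite (aE _ _ _ _ vX Xe) (aE _ _ _ _ vX Xf) => /Gi.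
    by rewrite !inE => /(_ Xe Xf)[-> ->].
- move=> v X y vX dy; have [[_ _ Gs] _] := GP _ _ vX.
  have [[e [x [Xe dx ->]]]|yN] := pselect (exists e x,
      [/\ X e, dom (rng e) (inl x) & y = inl (le e ** x)]).
    by exists e, (inl x).
  have [|[e n] Xe <-] := Gs y.
    by split=> // e x Xe dx yE; apply: yN; exists e, x.
  by exists e, (inr n); split=> //; apply: aE vX Xe.
Qed.

(** * Words acting on configurations *)

Section Action.

Variable a : edge E -> cfg -> cfg.

(** The output comes first, so that pullback turns [rcomp] into the product in the same order. *)
Definition redge e : vert E * cfg -> vert E * cfg -> Prop := fun p q =>
  [/\ p.1 = src e, q.1 = rng e, dom (rng e) q.2 & p.2 = a e q.2].

Definition rgen (g : li_gen E) : vert E * cfg -> vert E * cfg -> Prop :=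
  match g with
  | LIv v => diag [set q | q.1 = v /\ dom v q.2]
  | LIe (Fwd e) => redge e
  | LIe (Bwd e) => conv (redge e)
  end.

Definition rword (c : seq (li_gen E)) v :=
  foldr (fun g R => rcomp (rgen g) R) (rgen (LIv v)) c.

Hypothesis ca : complete a.

Lemma pbij_edge e : pbij (redge e).
Proof.
have [_ _ inj _] := ca; have [bX be] := blockP e.
split=> [[p1 p2] [q1 q2] [r1 r2]|[p1 p2] [q1 q2] [r1 r2]].
  move=> [/= -> -> dq ->] [/= _ -> dr qr].
  by have [_ ->] := inj _ _ _ _ _ _ bX be be dq dr qr.
by move=> [/= -> _ _ ->] [/= -> _ _ ->].
Qed.

Lemma pbij_gen g : pbij (rgen g).
Proof.
case: g => [v|[e|e]] /=; [exact: pbij_diag | exact: pbij_edge |].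
exact/pbij_conv/pbij_edge.
Qed.

Lemma pbij_word c v : pbij (rword c v).
Proof.
by elim: c => [|g c IHc]; [apply: pbij_gen | apply/pbij_comp/IHc/pbij_gen].
Qed.

Lemma pinv_neq0 s x : x <> szero -> pinv s ** (s ** x) = x -> s ** x <> szero.
Proof. by move=> x0 xE sx0; apply: x0; rewrite -xE sx0 muls0. Qed.

(* The configurations [inl x] carry the Wagner-Preston representation of       *)
(* [LI E] on its nonzero elements.                                            *)
Lemma rgen_inl g u w x : x <> szero -> lv u ** x = x ->
  lv w ** (li_of g ** x) = li_of g ** x ->
  pinv (li_of g) ** (li_of g ** x) = x ->
  rgen g (w, inl (li_of g ** x)) (u, inl x).
Proof.
have [aE _ _ _] := ca.
move=> x0 ux wy xE; have y0 := pinv_neq0 x0 xE; move: wy xE y0.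
case: g => [v|[e|e]] /=.
- move=> wx; rewrite pinv_v mulgA li_vv eqxx => vx _; rewrite vx in wx *.
  rewrite (vert_uniq x0 ux vx) (vert_uniq x0 wx vx).
  by [].
- move=> wx; rewrite pinv_e mulgA li_e'e => rx y0.
  split=> //=; first last.
  - by rewrite (vert_uniq x0 ux rx).
  - by apply: vert_uniq y0 wx _; rewrite mulgA (li_src (Fwd e)).
- move=> wx; rewrite pinv_e' => rx y0.
  have ry : lv (rng e) ** (le' e ** x) = le' e ** x.
    by rewrite mulgA (li_src (Bwd e)).
  split=> //=.
  - by apply: vert_uniq x0 ux _; rewrite -rx mulgA (li_src (Fwd e)).
  - exact: vert_uniq y0 wx ry.
  - by rewrite aE rx.
Qed.

Lemma rword_inl c v u w x : x <> szero -> lv u ** x = x ->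
  lv w ** (lword c v ** x) = lword c v ** x ->
  pinv (lword c v) ** (lword c v ** x) = x ->
  rword c v (w, inl (lword c v ** x)) (u, inl x).
Proof.
elim: c w => [|g c IHc] w /= x0 ux; first exact: rgen_inl.
move=> wy /pinv_mul_fix[fc fg]; have m0 := pinv_neq0 x0 fc.
have [z zm] := ex_vert m0.
exists (z, inl (lword c v ** x)); last exact: IHc.
by rewrite -mulgA in wy *; apply: rgen_inl.
Qed.

End Action.

(** Follow the word from the right to the first letter that fails in [LI E], at the point [y]. A
    vertex or a forward edge fails because [y] lies at another vertex. An inverse edge fails for
    that reason too, or because [ex_complete] can keep [y] out of the range of [e]. *)
Lemma rword_undefined c v u x : x <> szero -> lv u ** x = x ->
  pinv (lword c v) ** (lword c v ** x) <> x ->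
  exists2 a, complete a & forall p, ~ rword a c v p (u, inl x).
Proof.
move=> x0 ux; elim: c => [|g c IHc] /=.
  rewrite pinv_v mulgA li_vv eqxx => vx.
  have [a ca _] := ex_complete None; exists a => // p [-> [/= uv _]].
  by apply: vx; rewrite -uv.
have [fc|/IHc[a ca aN]] := pselect (pinv (lword c v) ** (lword c v ** x) = x);
  last by move=> _; exists a => // p [q _ /aN].
set y := lword c v ** x => fg.
have y0 : y <> szero := pinv_neq0 x0 fc.
have [w wy] := ex_vert y0.
have {}fg : pinv (li_of g) ** (li_of g ** y) <> y.
  by move=> fy; apply: fg; rewrite pinv_mul -!mulgA -/y fy.
suff [a ca aN] : exists2 a, complete a & forall p, ~ rgen a g p (w, inl y).
  exists a => // p [q pq qx]; apply: (aN p).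
  have wx := rword_inl ca x0 ux wy fc.
  (* The tail sends [(u, x)] to [(w, y)] and to nothing else. *)
  by rewrite -(proj2 (pbij_word ca c v) _ _ _ qx wx).
case: g fg => [t|[e|e]] /=.
- rewrite pinv_v mulgA li_vv eqxx => ty.
  have [a ca _] := ex_complete None; exists a => // p [-> [/= wt _]].
  by apply: ty; rewrite -wt.
- rewrite pinv_e mulgA li_e'e => ry.
  have [a ca _] := ex_complete None; exists a => // p [_ /= wr _ _].
  by apply: ry; rewrite -wr.
- rewrite pinv_e' => ey.
  have [ws|ws] := pselect (w = src e); last first.
    have [a ca _] := ex_complete None; exists a => // p [/= ws' _ _ _].
    exact: ws.
  have [bX be] := blockP e.
  (* If [e] were alone in its block, [e e^-1 = src e] would fix [y]. *)
  have bN : block e <> [set e].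
    move=> bE; apply: ey; rewrite bE in bX.
    by rewrite mulgA (li_single bX) -ws.
  have [a ca aN] := ex_complete (Some (e, y)); exists a => // p [_ _ dp yE].
  exact: (aN e y erefl bN ey _ dp (esym yE)).
Qed.

End LeavittInverseSemigroupTheory.

(** * The representation of the tame algebra given by a complete action *)

Section Representation.

Variables (K : comNzRingType) (conj : involutive_rmorphism K) (E : sepgraph).
Variable a : edge E -> cfg E -> cfg E.
Hypothesis ca : complete a.

Local Notation A := (dop K (vert E * cfg E)%type).
Local Notation dpull := (@dpull K (vert E * cfg E)%type).
Local Notation star := (@star K conj _).
Local Notation G := (range (@lpa_v K conj E) `|` range (@lpa_e K conj E)).

Definition rep_gen (g : lpa_gen E) : A :=
  match g with
  | LPv v => dpull (rgen a (LIv v))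
  | LPe e => dpull (redge a e)
  end.

Local Notation repv v := (rep_gen (LPv v)).
Local Notation repe e := (rep_gen (LPe e)).

Let pb := pbij_gen ca.

Lemma rep_v_star v : star (repv v) = repv v.
Proof. by rewrite /rep_gen dpull_star conv_diag. Qed.

Lemma rep_vv v w : repv v ** repv w = if v == w then repv v else 0.
Proof.
rewrite /rep_gen dpull_comp //; case: (eqVneq v w) => [<-|vw].
  congr dpull; apply: rel_ext => p q.
  by split=> [[_ [<- ?] [<- _]]|[<- ?]]; [|exists p].
rewrite -dpull_empty; congr dpull; apply: rel_ext => p q.
by split=> // -[_ [<- [vp _]] [_ [wp _]]]; rewrite -vp -wp eqxx in vw.
Qed.

Lemma rep_se e : repv (src e) ** repe e = repe e.
Proof.
rewrite /rep_gen dpull_comp; [|exact: pb|exact: pbij_edge].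
congr dpull; apply: rel_ext => p q; split=> [[_ [<- _]]//|pq].
exists p => //; split=> //; case: pq => ps _ dq pE.
by split=> //=; rewrite pE; have [_ aD _ _] := ca; apply: aD.
Qed.

Lemma rep_er e : repe e ** repv (rng e) = repe e.
Proof.
rewrite /rep_gen dpull_comp; [|exact: pbij_edge|exact: pb].
congr dpull; apply: rel_ext => p q; split=> [[z pz [<- _]]//|pq].
by exists q => //; split=> //; case: pq.
Qed.

Lemma rep_ef v X e f : sep v X -> X e -> X f ->
  star (repe e) ** repe f = if e == f then repv (rng e) else 0.
Proof.
move=> vX Xe Xf; have [_ _ inj _] := ca.
rewrite /rep_gen dpull_star dpull_comp; last 2 first.
- exact/pbij_conv/pbij_edge.
- exact: pbij_edge.
case: (eqVneq e f) => [<-|ef].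
  congr dpull; apply: rel_ext => -[p1 p2] [q1 q2]; split.
    move=> [z [_ /= -> dp zp] [_ /= -> dq zq]].
    have := zq; rewrite zp => /(inj _ _ _ _ _ _ vX Xe Xe dp dq)[_ ->].
    by [].
  move=> [[<- <-] [/= -> dp]].
  by exists (src e, a e p2).
rewrite -dpull_empty; congr dpull; apply: rel_ext => p q; split=> //.
move=> [z [_ _ dp zp] [_ _ dq zq]].
have := zq; rewrite zp => /(inj _ _ _ _ _ _ vX Xe Xf dp dq)[efE _].
by rewrite efE eqxx in ef.
Qed.

Lemma rep_sum v X : sep v X -> finite_set X ->
  \sum_(e <- fset_set X) repe e ** star (repe e) = repv v.
Proof.
move=> vX finX; have [_ aD inj sur] := ca.
pose P e : set (vert E * cfg E) := [set p | exists q, redge a e p q].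
have peE e : repe e ** star (repe e) = dpull (diag (P e)).
  rewrite /rep_gen dpull_star dpull_comp; last 2 first.
  - exact: pbij_edge.
  - exact/pbij_conv/pbij_edge.
  congr dpull; apply: rel_ext => p q.
  by rewrite (comp_convP _ _ (pbij_edge ca e)).
rewrite (eq_bigr _ (fun e _ => peE e)) dpull_diag_sum ?fset_uniq //.
  congr (dpull (diag _)); apply/seteqP; split=> [p [e]|[p1 p2] [/= -> dp]] /=.
    rewrite in_fset_set // inE => Xe [q [-> _ dq ->]].
    by rewrite -(sep_src vX Xe); split=> //; apply: aD.
  have [e [y [Xe dy ye]]] := sur _ _ _ vX dp.
  exists e; first by rewrite in_fset_set // inE.
  by exists (rng e, y); split; rewrite ?(sep_src vX Xe).
move=> e f; rewrite !in_fset_set // !inE => Xe Xf ef.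
rewrite -subset0 => p [[q [_ _ dq pq]] [r [_ _ dr]]].
rewrite pq => /(inj _ _ _ _ _ _ vX Xe Xf dq dr)[efE _].
by rewrite efE eqxx in ef.
Qed.

Lemma rep_rel b c : lpa_rel b c ->
  @sa_eval K conj _ A rep_gen b = @sa_eval K conj _ A rep_gen c.
Proof.
case.
- by move=> v; apply: rep_v_star.
- by move=> v w /=; rewrite [LHS]rep_vv; case: ifP.
- by move=> e; apply: rep_se.
- by move=> e; apply: rep_er.
- by move=> e /=; rewrite -[X in _ ** X]rep_v_star -starM [X in star X]rep_se.
- by move=> e /=; rewrite -[X in X ** _]rep_v_star -starM [X in star X]rep_er.
- move=> X e f [v _ vX] Xe Xf /=.
  by rewrite [LHS](rep_ef vX Xe Xf); case: ifP.
- move=> v X vX finX; rewrite -[RHS](rep_sum vX finX).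
  by elim/big_ind2: _ => //= x y z t -> ->.
Qed.

Definition rep : LPA conj E -> A := sa_lift rep_gen.

Lemma repM x y : rep (x ** y) = rep x ** rep y.
Proof. exact: (sa_liftM rep_rel). Qed.

Lemma repS x : rep (star x) = star (rep x).
Proof. exact: (sa_liftS rep_rel). Qed.

Lemma repD x y : rep (x + y) = rep x + rep y.
Proof. exact: (sa_liftD rep_rel). Qed.

Lemma repZ k x : rep (k *: x) = k *: rep x.
Proof. exact: (sa_liftZ rep_rel). Qed.

Lemma rep_starsemi x : starsemi G x -> exists2 R, pbij R & rep x = dpull R.
Proof.
elim=> {x} [_ [[v _ <-]|[e _ <-]]|x y _ [R bR xR] _ [S bS yS]|x _ [R bR xR]].
- by exists (rgen a (LIv v)); [apply: pb | apply: (sa_lift_gen rep_rel)].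
- by exists (redge a e); [apply: pbij_edge | apply: (sa_lift_gen rep_rel)].
- by exists (rcomp R S); [apply: pbij_comp | rewrite repM xR yS dpull_comp].
- by exists ((fun x y => R y x)); [apply: pbij_conv |
    rewrite repS xR dpull_star].
Qed.

(** Elements of the star-subsemigroup act as partial bijections, so each [x ** star x] acts as a
    restriction of the identity, and such restrictions commute. *)
Lemma rep_tame x : ideal_gen (tame_commutators G) x -> rep x = 0.
Proof.
have rep0 : rep 0 = 0 by rewrite -(scale0r 0) repZ scale0r.
elim=> {x} [_ [x [y [Gx Gy ->]]]||x y _ IHx _ IHy|k x _ IHx|x y _ IHy|x y _ IHx].
- have [R bR xR] := rep_starsemi Gx; have [S bS yS] := rep_starsemi Gy.
  rewrite repD -scaleN1r repZ scaleN1r !repM !repS xR yS !dpull_star.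
  have bR' := pbij_conv bR; have bS' := pbij_conv bS.
  have bRR := pbij_comp bR bR'; have bSS := pbij_comp bS bS'.
  by rewrite !dpull_comp // comp_conv_comm // subrr.
- exact: rep0.
- by rewrite repD IHx IHy addr0.
- by rewrite repZ IHx scaler0.
- by rewrite repM IHy; apply: samul0.
- by rewrite repM IHx; apply: sa0mul.
Qed.

Definition lpa_of (g : li_gen E) : LPA conj E :=
  match g with
  | LIv v => lpa_v conj v
  | LIe (Fwd e) => lpa_e conj e
  | LIe (Bwd e) => star (lpa_e conj e)
  end.

Definition lpa_word (c : seq (li_gen E)) v : LPA conj E :=
  foldr (fun g y => lpa_of g ** y) (lpa_v conj v) c.

Lemma ab_pi_word c v : ab_pi (lpa_word c v) = li_iota conj (lword c v).
Proof.
elim: c => [|g c IHc] /=; first by rewrite li_iota_v.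
rewrite ab_piM li_iotaM IHc; congr (_ ** _).
by case: g => [u|[e|e]] /=; rewrite ?ab_piS ?li_iota_v ?li_iota_e ?li_iota_einv.
Qed.

Lemma rep_word c v : rep (lpa_word c v) = dpull (rword a c v).
Proof.
elim: c => [|g c IHc] /=; first exact: (sa_lift_gen rep_rel).
rewrite repM IHc -dpull_comp; [|exact: pb|exact: pbij_word].
congr (_ ** _).
case: g => [u|[e|e]] /=; try exact: (sa_lift_gen rep_rel).
by rewrite repS -(dpull_star conj); congr star; apply: (sa_lift_gen rep_rel).
Qed.

(** Passes from the algebra to points: the representation kills the tame ideal, and an operator
    [dpull R] determines [R]. *)
Lemma li_iota_rword c v d w :
  li_iota conj (lword c v) = li_iota conj (lword d w) ->
  rword a c v = rword a d w.
Proof.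
rewrite -!ab_pi_word => /tame_piP/rep_tame.
rewrite repD -scaleN1r repZ scaleN1r !rep_word => /eqP; rewrite subr_eq0.
by move=> /eqP/dpull_inj; apply; apply: pbij_word.
Qed.

Lemma li_iota_rword0 c v : li_iota conj (lword c v) = 0 ->
  rword a c v = rempty.
Proof.
rewrite -ab_pi_word.
have -> : (0 : LPAab conj E) = ab_pi 0 by [].
move=> /tame_piP/rep_tame; rewrite subr0 rep_word -dpull_empty.
by apply: dpull_inj; [apply: pbij_word | apply: pbij_empty].
Qed.

End Representation.

(** * Injectivity through the natural partial order *)

Section Injectivity.

Variables (K : comNzRingType) (conj : involutive_rmorphism K) (E : sepgraph).
Implicit Types s t : LI E.

Local Notation iota := (@li_iota K conj E).
Local Notation pinv := (@Defs.pinv _).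

Lemma rword_source a c v : complete a -> lword c v <> szero :> LI E ->
  exists u w : vert E,
    let x := pinv (lword c v) ** lword c v in
    [/\ x <> szero, li_of (LIv u) ** x = x &
        rword a c v (w, inl (lword c v)) (u, inl x)].
Proof.
set s := lword c v => ca s0; pose x := pinv s ** s.
have sx : s ** x = s by rewrite /x mulgA mulsVs.
have x0 : x <> szero by move=> x0; apply: s0; rewrite -sx x0 muls0.
have [u ux] := ex_vert x0; have [w ws] := ex_vert s0.
exists u, w; split=> //.
by rewrite -[in inl s]sx; apply: rword_inl; rewrite //= -/s sx.
Qed.

Lemma li_iota_eq0 s : iota s = 0 -> s = szero.
Proof.
case: (iswordP s) => [//|[c [v ->]]] s_0; apply: contrapT => s0.
have [a ca _] := ex_complete (@None (edge E * LI E)).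
have [u [w [_ _]]] := rword_source ca s0.
by rewrite (li_iota_rword0 ca s_0).
Qed.

(** The conclusion is [s <= t] in the natural partial order of an inverse semigroup. *)
Lemma li_iota_le s t : iota s = iota t -> t ** (pinv s ** s) = s.
Proof.
move=> st; have [->|s0] := pselect (s = szero); first by rewrite !muls0.
case: (iswordP t) => [tE|[d [w tE]]].
  by case: s0; apply: li_iota_eq0; rewrite st tE li_iota0.
case: (iswordP s) => [//|[c [v sE]]].
rewrite {}sE {}tE in st s0 *.
pose x := pinv (lword c v) ** lword c v; rewrite -/x.
have [a0 ca0 _] := ex_complete (@None (edge E * LI E)).
have [u [_ [x0 ux _]]] := rword_source ca0 s0.
rewrite -/x in x0 ux.
have [tx|tx] := pselect (pinv (lword d w) ** (lword d w ** x) = x).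
  (* [s] and [t x] are images of [x] under the same partial bijection. *)
  have [u' [z [_ u'x sR]]] := rword_source ca0 s0.
  have [z' z't] := ex_vert (pinv_neq0 x0 tx).
  have tR := rword_inl ca0 x0 u'x z't tx.
  rewrite (li_iota_rword ca0 st) in sR.
  by have [_ ->] := proj2 (pbij_word ca0 d w) _ _ _ tR sR.
(* For this action the word of [t] is undefined at [x], whereas that of [s] is defined there. *)
have [a ca aN] := rword_undefined x0 ux tx.
have [u' [z [_ u'x sR]]] := rword_source ca s0.
rewrite (li_iota_rword ca st) -(vert_uniq x0 ux u'x) in sR.
by case: (aN _ sR).
Qed.

(** Antisymmetry of the natural order: put [s = t s^-1 s] into [t = s t^-1 t] and commute the
    idempotents. *)
Lemma li_iota_inj : injective iota.
Proof.
move=> s t st; have ts := li_iota_le st; have := li_iota_le (esym st).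
rewrite -{1}ts -mulgA (idem_comm (pinv_source_idem s) (pinv_source_idem t)).
by rewrite mulgA [t ** _]mulgA mulsVs ts.
Qed.

Lemma li_iota_surj (z : LPAab conj E) : gensemi0 (@lpaab_gens K conj E) z ->
  exists s, iota s = z.
Proof.
elim=> {z} [|z|y z _ [s <-] _ [t <-]].
- by exists szero; rewrite li_iota0.
- case=> [[[v _ <-]|[e _ <-]]|[e _ <-]].
  + by exists (li_of (LIv v)); rewrite li_iota_v.
  + by exists (li_of (LIe (Fwd e))); rewrite li_iota_e.
  + by exists (li_of (LIe (Bwd e))); rewrite li_iota_einv.
- by exists (s ** t); rewrite li_iotaM.
Qed.

End Injectivity.

Theorem theorem4p9 (E : sepgraph) (K : comNzRingType)
    (conj : involutive_rmorphism K) :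
  injective (@li_iota K conj E) /\
  (exists phi : LI E -> LPAsemi conj E,
    [/\ bijective phi,
        {morph phi : x y / x ** y},
        phi szero = szero &
        forall x : LI E, val (phi x) = li_iota conj x]).
Proof.
split; first exact: li_iota_inj.
exists (@li_iota_semi K conj E); split=> //.
- have /choice[g gK] (z : LPAsemi conj E) : exists s, li_iota conj s = val z.
    exact/li_iota_surj/set_valP.
  exists g => [s|z]; last exact/val_inj/gK.
  by apply: (@li_iota_inj K conj E); apply: gK.
- by move=> x y; apply: val_inj; rewrite ls_valM; apply: li_iotaM.
- by apply: val_inj; apply: li_iota0.
Qed.
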